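(* Let $\mathcal{P}=(\mathcal{P},m,\Delta,\delta)$ be a connected double twisted bialgebra. There exists a unique morphism $\phi$ of double bialgebras from $\mathcal{P}$ to $\mathcal{C}omp$. Moreover, the following maps are bijections, inverse one from the other: \begin{align*} \varsigma&:\left\{\begin{array}{rcl} \mathrm{Char}(\mathcal{P})&\longrightarrow&\mathrm{Mor}_B(\mathcal{P},\mathcal{C}omp)\\ f&\longrightarrow&\phi\leftarrow f, \end{array}\right.\\ \varsigma'&:\left\{\begin{array}{rcl} \mathrm{Mor}_B(\mathcal{P},\mathcal{C}omp)&\longrightarrow&\mathrm{Char}(\mathcal{P})\\ \phi&\longrightarrow&\varepsilon'\circ \phi. \end{array}\right. \end{align*}
   Context: A double twisted bialgebra is a twisted bialgebra $(\mathcal{P},m,\Delta)$ (bialgebra for the Cauchy tensor product of species) with, for each finite set $A$, a coassociative counital coproduct $\delta_A:\mathcal{P}[A]\to\mathcal{P}[A]\otimes\mathcal{P}[A]$ (counit $\varepsilon'$), natural in $A$, multiplicative, with $(\Delta_{A,B}\otimes Id)\circ\delta_{A\sqcup B}=m_{1,3,24}\circ(\delta_A\otimes\delta_B)\circ\Delta_{A,B}$ where $m_{1,3,24}(x\otimes y\otimes z\otimes t)=x\otimes z\otimes m_{A,B}(y\otimes t)$, and compatible counit $\varepsilon$. Connected means $\mathcal{P}[\emptyset]$ is one-dimensional. $\mathrm{Char}(\mathcal{P})$ is the set of twisted algebra morphisms $\mathcal{P}\to\mathcal{C}om$ ($\mathcal{C}om[A]=\mathbb{K}$ with multiplication of scalars),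 $\mathrm{Mor}_B(\mathcal{P},\mathcal{C}omp)$ is the set of twisted bialgebra morphisms $\mathcal{P}\to\mathcal{C}omp$, and $\phi\leftarrow f=(\phi\otimes f)\circ\delta$. $\mathcal{C}omp[A]$ has basis the set compositions $(A_1,\ldots,A_k)$ of $A$, with quasi-shuffle product $\uplus$: $(A_1,\ldots,A_k)\uplus(A_{k+1},\ldots,A_{k+l})=\sum_{\sigma\in QSh(k,l)}\big(\bigcup_{\sigma(i)=1}A_i,\ldots,\bigcup_{\sigma(i)=\max\sigma}A_i\big)$ ($QSh(k,l)$: surjections $\{1,\ldots,k+l\}\to\{1,\ldots,\max\sigma\}$ nondecreasing on $\{1,\ldots,k\}$ and $\{k+1,\ldots,k+l\}$), deconcatenation coproduct $\Delta$, and second coproduct $\delta_A(A_1,\ldots,A_k)=\sum_{1\le i_1<\cdots<i_p<k}(A_1\sqcup\cdots\sqcup A_{i_1},\ldots,A_{i_p+1}\sqcup\cdots\sqcup A_k)\otimes(A_1,\ldots,A_{i_1})\uplus\cdots\uplus(A_{i_p+1},\ldots,A_k)$, whose counit is $\varepsilon'(A_1,\ldots,A_k)=\delta_{k,1}$.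
   Formalization: Quasi-shuffles are taken strictly increasing, not merely nondecreasing, on each block (else the empty composition is no unit), and ε' of the empty composition is 1 instead of 0 (needed for counitality); species are taken on finite subsets of the natural numbers. *)

(* Defs.v *)
From HB Require Import structures.
From mathcomp Require Import all_boot all_order all_algebra.
From mathcomp Require Import finmap.
Set Implicit Arguments. Unset Strict Implicit. Unset Printing Implicit Defensive.
Import GRing.Theory.
Local Open Scope fset_scope.
Local Open Scope ring_scope.

Notation lset := {fset nat}.

Definition bigU (w : seq lset) : lset := foldr fsetU fset0 w.

Definition img (s : nat -> nat) (A : lset) : lset := [fset s a | a in A].

(* All spaces P[A] are subspaces [sub A] of one ambient K-vector space *)
(* V; every structure map is indexed by the relevant finite sets and   *)
(* only its values on the relevant subspaces matter.  Elements of      *)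
(* P[A] (x) P[B] are represented by lists of pairs (finite sums of     *)
(* elementary tensors); two of them are equal iff all functionals      *)
(* f (x) g agree on them (this characterizes equality in V (x) V over  *)
(* a field).                                                            *)
Record dtb_data (K : fieldType) := DTB {
  PV : lmodType K;
  Psub : lset -> {pred PV};
  Pact : (nat -> nat) -> lset -> PV -> PV;
  Pone : PV;
  Pmul : lset -> lset -> PV -> PV -> PV;
  PDelta : lset -> lset -> PV -> seq (PV * PV);
  Peps : PV -> K;
  Pdelta : lset -> PV -> seq (PV * PV);
  Peps' : lset -> PV -> K
}.
Arguments Psub {K} d _ : rename.
Arguments Pact {K} d _ _ _ : rename.
Arguments Pone {K} d : rename.
Arguments Pmul {K} d _ _ _ _ : rename.
Arguments PDelta {K} d _ _ _ : rename.
Arguments Peps {K} d _ : rename.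
Arguments Pdelta {K} d _ _ : rename.
Arguments Peps' {K} d _ _ : rename.


Section Tensors.
Variables (K : fieldType) (V : lmodType K).
Definition teval2 (f g : {scalar V}) (s : seq (V * V)) : K :=
  \sum_(p <- s) f p.1 * g p.2.
Definition teq2 (s t : seq (V * V)) : Prop :=
  forall f g : {scalar V}, teval2 f g s = teval2 f g t.
Definition teval3 (f g h : {scalar V}) (s : seq (V * V * V)) : K :=
  \sum_(p <- s) f p.1.1 * g p.1.2 * h p.2.
Definition teq3 (s t : seq (V * V * V)) : Prop :=
  forall f g h : {scalar V}, teval3 f g h s = teval3 f g h t.
Definition tscale (a : K) (s : seq (V * V)) : seq (V * V) :=
  [seq (a *: p.1, p.2) | p <- s].
End Tensors.

Definition disj (A B : lset) : bool := [disjoint A & B]%fset.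
Definition injon (s : nat -> nat) (A : lset) : Prop := {in A &, injective s}.

Record is_dtb (K : fieldType) (P : dtb_data K) : Prop := {
  sub_0 : forall A, (0 : PV P) \in Psub P A;
  sub_lin : forall A (a : K) (x y : PV P),
    x \in Psub P A -> y \in Psub P A -> a *: x + y \in Psub P A;
  act_sub : forall s A x, injon s A -> x \in Psub P A -> Pact P s A x \in Psub P (img s A);
  act_lin : forall s A (a : K) x y, injon s A -> x \in Psub P A -> y \in Psub P A ->
    Pact P s A (a *: x + y) = a *: Pact P s A x + Pact P s A y;
  act_ext : forall s t A x, {in A, s =1 t} -> x \in Psub P A ->
    Pact P s A x = Pact P t A x;
  act_id : forall A x, x \in Psub P A -> Pact P id A x = x;
  act_comp : forall s t A x, injon s A -> injon t (img s A) -> x \in Psub P A ->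
    Pact P t (img s A) (Pact P s A x) = Pact P (t \o s) A x;
  one_sub : Pone P \in Psub P fset0;
  mul_sub : forall A B x y, disj A B -> x \in Psub P A -> y \in Psub P B ->
    Pmul P A B x y \in Psub P (A `|` B);
  mul_linl : forall A B (a : K) x x' y, disj A B -> x \in Psub P A -> x' \in Psub P A ->
    y \in Psub P B -> Pmul P A B (a *: x + x') y = a *: Pmul P A B x y + Pmul P A B x' y;
  mul_linr : forall A B (a : K) x y y', disj A B -> x \in Psub P A -> y \in Psub P B ->
    y' \in Psub P B -> Pmul P A B x (a *: y + y') = a *: Pmul P A B x y + Pmul P A B x y';
  mul_assoc : forall A B C x y z, disj A B -> disj A C -> disj B C ->
    x \in Psub P A -> y \in Psub P B -> z \in Psub P C ->
    Pmul P (A `|` B) C (Pmul P A B x y) z = Pmul P A (B `|` C) x (Pmul P B C y z);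
  mul_1l : forall A x, x \in Psub P A -> Pmul P fset0 A (Pone P) x = x;
  mul_1r : forall A x, x \in Psub P A -> Pmul P A fset0 x (Pone P) = x;
  mul_nat : forall s A B x y, injon s (A `|` B) -> disj A B ->
    x \in Psub P A -> y \in Psub P B ->
    Pact P s (A `|` B) (Pmul P A B x y)
    = Pmul P (img s A) (img s B) (Pact P s A x) (Pact P s B y);
  Delta_sub : forall A B x, disj A B -> x \in Psub P (A `|` B) ->
    all (fun p => (p.1 \in Psub P A) && (p.2 \in Psub P B)) (PDelta P A B x);
  Delta_lin : forall A B (a : K) x y, disj A B ->
    x \in Psub P (A `|` B) -> y \in Psub P (A `|` B) ->
    teq2 (PDelta P A B (a *: x + y)) (tscale a (PDelta P A B x) ++ PDelta P A B y);
  Delta_coass : forall A B C x, disj A B -> disj A C -> disj B C ->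
    x \in Psub P (A `|` B `|` C) ->
    teq3 (flatten [seq [seq (q.1, q.2, p.2) | q <- PDelta P A B p.1]
                  | p <- PDelta P (A `|` B) C x])
         (flatten [seq [seq (p.1, q.1, q.2) | q <- PDelta P B C p.2]
                  | p <- PDelta P A (B `|` C) x]);
  eps_lin : forall (a : K) x y, x \in Psub P fset0 -> y \in Psub P fset0 ->
    Peps P (a *: x + y) = a * Peps P x + Peps P y;
  Delta_counitl : forall A x, x \in Psub P A ->
    \sum_(p <- PDelta P fset0 A x) Peps P p.1 *: p.2 = x;
  Delta_counitr : forall A x, x \in Psub P A ->
    \sum_(p <- PDelta P A fset0 x) Peps P p.2 *: p.1 = x;
  Delta_nat : forall s A B x, injon s (A `|` B) -> disj A B -> x \in Psub P (A `|` B) ->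
    teq2 (PDelta P (img s A) (img s B) (Pact P s (A `|` B) x))
         [seq (Pact P s A p.1, Pact P s B p.2) | p <- PDelta P A B x];
  Delta_mul : forall A B C D x y, disj A B -> disj C D -> A `|` B = C `|` D ->
    x \in Psub P A -> y \in Psub P B ->
    teq2 (PDelta P C D (Pmul P A B x y))
         (flatten [seq [seq (Pmul P (A `&` C) (B `&` C) p.1 q.1,
                             Pmul P (A `&` D) (B `&` D) p.2 q.2)
                       | q <- PDelta P (B `&` C) (B `&` D) y]
                  | p <- PDelta P (A `&` C) (A `&` D) x]);
  Delta_one : teq2 (PDelta P fset0 fset0 (Pone P)) [:: (Pone P, Pone P)];
  eps_mul : forall x y, x \in Psub P fset0 -> y \in Psub P fset0 ->
    Peps P (Pmul P fset0 fset0 x y) = Peps P x * Peps P y;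
  eps_one : Peps P (Pone P) = 1;
  delta_sub : forall A x, x \in Psub P A ->
    all (fun p => (p.1 \in Psub P A) && (p.2 \in Psub P A)) (Pdelta P A x);
  delta_lin : forall A (a : K) x y, x \in Psub P A -> y \in Psub P A ->
    teq2 (Pdelta P A (a *: x + y)) (tscale a (Pdelta P A x) ++ Pdelta P A y);
  delta_coass : forall A x, x \in Psub P A ->
    teq3 (flatten [seq [seq (q.1, q.2, p.2) | q <- Pdelta P A p.1] | p <- Pdelta P A x])
         (flatten [seq [seq (p.1, q.1, q.2) | q <- Pdelta P A p.2] | p <- Pdelta P A x]);
  eps'_lin : forall A (a : K) x y, x \in Psub P A -> y \in Psub P A ->
    Peps' P A (a *: x + y) = a * Peps' P A x + Peps' P A y;
  delta_counitl : forall A x, x \in Psub P A ->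
    \sum_(p <- Pdelta P A x) Peps' P A p.1 *: p.2 = x;
  delta_counitr : forall A x, x \in Psub P A ->
    \sum_(p <- Pdelta P A x) Peps' P A p.2 *: p.1 = x;
  delta_nat : forall s A x, injon s A -> x \in Psub P A ->
    teq2 (Pdelta P (img s A) (Pact P s A x))
         [seq (Pact P s A p.1, Pact P s A p.2) | p <- Pdelta P A x];
  eps'_nat : forall s A x, injon s A -> x \in Psub P A ->
    Peps' P (img s A) (Pact P s A x) = Peps' P A x;
  delta_mul : forall A B x y, disj A B -> x \in Psub P A -> y \in Psub P B ->
    teq2 (Pdelta P (A `|` B) (Pmul P A B x y))
         [seq (Pmul P A B p.1 q.1, Pmul P A B p.2 q.2) | p <- Pdelta P A x, q <- Pdelta P B y];
  delta_one : teq2 (Pdelta P fset0 (Pone P)) [:: (Pone P, Pone P)];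
  eps'_mul : forall A B x y, disj A B -> x \in Psub P A -> y \in Psub P B ->
    Peps' P (A `|` B) (Pmul P A B x y) = Peps' P A x * Peps' P B y;
  eps'_one : Peps' P fset0 (Pone P) = 1;
  Delta_delta : forall A B x, disj A B -> x \in Psub P (A `|` B) ->
    teq3 (flatten [seq [seq (q.1, q.2, p.2) | q <- PDelta P A B p.1]
                  | p <- Pdelta P (A `|` B) x])
         (flatten [seq [seq (a.1, b.1, Pmul P A B a.2 b.2)
                       | a <- Pdelta P A p.1, b <- Pdelta P B p.2]
                  | p <- PDelta P A B x]);
  eps_delta : forall x, x \in Psub P fset0 ->
    \sum_(p <- Pdelta P fset0 x) Peps P p.1 *: p.2 = Peps P x *: Pone P
}.

Definition connected (K : fieldType) (P : dtb_data K) : Prop :=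
  exists e : PV P, [/\ e \in Psub P fset0, e != 0 &
    forall x, x \in Psub P fset0 -> exists a : K, x = a *: e].

(* The double twisted bialgebra Comp.  An element of Comp[A] is a      *)
(* finite formal linear combination of set compositions of A, given as *)
(* a list of (coefficient, word) pairs; equality is equality of        *)
(* coefficient functions [coef].  Similarly for Comp (x) Comp.        *)
Notation word := (seq lset).

Definition is_comp (A : lset) (w : word) : bool :=
  all (fun X => X != fset0) w && pairwise disj w && (bigU w == A).

Section Comp.
Variable K : fieldType.
Definition fs := seq (K * word).
Definition fs2 := seq (K * (word * word)).
Definition coef (u : fs) (c : word) : K := \sum_(p <- u | p.2 == c) p.1.
Definition coef2 (u : fs2) (c : word * word) : K := \sum_(p <- u | p.2 == c) p.1.

(* (k,l)-quasi-shuffles, 0-indexed: sigma : {0..k+l-1} -> {0..max sigma}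
   surjective, strictly increasing on {0..k-1} and on {k..k+l-1}. *)
Definition qsh_max n (sg : {ffun 'I_n -> 'I_n}) : nat := \max_(i : 'I_n) (sg i).+1.
Definition is_qsh k l (sg : {ffun 'I_(k + l) -> 'I_(k + l)}) : bool :=
  [&& [forall j : 'I_(k + l), (j < qsh_max sg)%N ==> [exists i, sg i == j]],
      [forall i : 'I_(k + l), forall i' : 'I_(k + l),
         ((i < i')%N && (i' < k)%N) ==> (sg i < sg i')%N] &
      [forall i : 'I_(k + l), forall i' : 'I_(k + l),
         ((k <= i)%N && (i < i')%N) ==> (sg i < sg i')%N]].

Definition qsh_words (a b : word) : seq word :=
  let n := (size a + size b)%N in
  [seq [seq \big[fsetU/fset0]_(i : 'I_n | sg i == j :> nat) nth fset0 (a ++ b) i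
       | j <- iota 0 (qsh_max sg)]
  | sg : {ffun 'I_n -> 'I_n} <- enum [pred sg : {ffun 'I_n -> 'I_n} | @is_qsh (size a) (size b) sg]].

Definition fs_mul (u v : fs) : fs :=
  flatten [seq [seq (p.1 * q.1, w) | w <- qsh_words p.2 q.2] | p <- u, q <- v].

Definition fs_unit : fs := [:: (1, [::])].

Definition fs_act (s : nat -> nat) (u : fs) : fs :=
  [seq (p.1, [seq img s X | X <- p.2]) | p <- u].

Definition comp_Delta (A B : lset) (u : fs) : fs2 :=
  flatten [seq [seq (p.1, (take i p.2, drop i p.2))
               | i <- iota 0 (size p.2).+1 & bigU (take i p.2) == A]
          | p <- u].

(* the consecutive pieces of a word w cut at the positions of C
   (positions in {1,...,size w - 1}) *)
Definition pieces (w : word) (C : seq nat) : seq word :=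
  if w is [::] then [::] else
  let bs := 0%N :: rcons (sort leq C) (size w) in
  [seq drop (nth 0%N bs j) (take (nth 0%N bs j.+1) w) | j <- iota 0 (size bs).-1].

Definition fs_prod (ps : seq word) : fs :=
  foldr (fun s acc => fs_mul [:: (1, s)] acc) fs_unit ps.

Definition comp_delta_word (w : word) : fs2 :=
  flatten [seq (let ps := pieces w [seq val i | i <- enum C] in
                [seq (q.1, ([seq bigU X | X <- ps], q.2)) | q <- fs_prod ps])
          | C : {set 'I_(size w)} <- enum [pred C : {set 'I_(size w)} | [forall i, (i \in C) ==> (val i != 0%N)]]].

Definition comp_delta (u : fs) : fs2 :=
  flatten [seq [seq (p.1 * q.1, q.2) | q <- comp_delta_word p.2] | p <- u].

Definition comp_eps' (u : fs) : K := \sum_(p <- u) p.1 * (size p.2 <= 1)%:R.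
End Comp.

Section Morphisms.
Variables (K : fieldType) (P : dtb_data K).

Definition morph := lset -> PV P -> fs K.
Definition charf := lset -> PV P -> K.

Definition phi2 (phi : morph) (A B : lset) (s : seq (PV P * PV P)) : fs2 K :=
  flatten [seq [seq (a.1 * b.1, (a.2, b.2)) | a <- phi A p.1, b <- phi B p.2] | p <- s].

Record is_bimorph (phi : morph) : Prop := {
  bm_support : forall A x, x \in Psub P A -> all (fun p => is_comp A p.2) (phi A x);
  bm_lin : forall A (a : K) x y, x \in Psub P A -> y \in Psub P A ->
    coef (phi A (a *: x + y)) =1 (fun c => a * coef (phi A x) c + coef (phi A y) c);
  bm_nat : forall s A x, injon s A -> x \in Psub P A ->
    coef (phi (img s A) (Pact P s A x)) =1 coef (fs_act s (phi A x));
  bm_mul : forall A B x y, disj A B -> x \in Psub P A -> y \in Psub P B ->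
    coef (phi (A `|` B) (Pmul P A B x y)) =1 coef (fs_mul (phi A x) (phi B y));
  bm_one : coef (phi fset0 (Pone P)) =1 coef (fs_unit K);
  bm_Delta : forall A B x, disj A B -> x \in Psub P (A `|` B) ->
    coef2 (phi2 phi A B (PDelta P A B x)) =1 coef2 (comp_Delta A B (phi (A `|` B) x));
  bm_eps : forall x, x \in Psub P fset0 -> coef (phi fset0 x) [::] = Peps P x
}.

Definition is_dmorph (phi : morph) : Prop :=
  [/\ is_bimorph phi,
      (forall A x, x \in Psub P A ->
         coef2 (phi2 phi A A (Pdelta P A x)) =1 coef2 (comp_delta (phi A x))) &
      (forall A x, x \in Psub P A -> comp_eps' (phi A x) = Peps' P A x)].

Definition is_char (f : charf) : Prop :=
  [/\ (forall A (a : K) x y, x \in Psub P A -> y \in Psub P A ->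
         f A (a *: x + y) = a * f A x + f A y),
      (forall s A x, injon s A -> x \in Psub P A -> f (img s A) (Pact P s A x) = f A x),
      (forall A B x y, disj A B -> x \in Psub P A -> y \in Psub P B ->
         f (A `|` B) (Pmul P A B x y) = f A x * f B y) &
      f fset0 (Pone P) = 1].

Definition arrow (phi : morph) (f : charf) : morph :=
  fun A x => flatten [seq [seq (f A q.2 * p.1, p.2) | p <- phi A q.1] | q <- Pdelta P A x].

Definition eps'_comp (phi : morph) : charf := fun A x => comp_eps' (phi A x).

Definition same_morph (phi psi : morph) : Prop :=
  forall A x, x \in Psub P A -> coef (phi A x) =1 coef (psi A x).
Definition same_char (f g : charf) : Prop :=
  forall A x, x \in Psub P A -> f A x = g A x.
End Morphisms.

(* Main.v *)
(** For a family of functionals f_A : P[A] -> K, let f_w be the composite of the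
    iterated coproduct Delta_(A1,...,Ak) with f_A1 (x) ... (x) f_Ak, where
    w = (A1,...,Ak) (and f_w = epsilon for the empty word).  A bialgebra morphism
    phi is determined by f = eps' o phi: the compatibility with Delta forces the
    coefficient of w in phi x to be f_w x.  Conversely these coefficients define a
    bialgebra morphism for every character f, because f_w (x y) is
    f_(w restricted to A) x * f_(w restricted to B) y, and w occurs in a
    quasi-shuffle of a and b, exactly once, iff its restrictions are a and b.
    The compatibility of Delta with delta gives
    (eps'_w (x) g_A) o delta = g_w for every multiplicative family g.  With g
    a character, the morphism attached to eps', acted on by g, is the one attached
    to g; with g_B = eps'_(v restricted to B), the morphism attached to
    eps' respects delta. *)
From HB Require Import structures.
From mathcomp Require Import boolp classical_sets.
From mathcomp Require Import all_boot all_order all_algebra.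
From mathcomp Require Import finmap.
Require Import Defs.
Set Implicit Arguments. Unset Strict Implicit. Unset Printing Implicit Defensive.
Import GRing.Theory.
Local Open Scope fset_scope.

(** * Restriction of set compositions *)

(** Apart from restriction, [drop_empty [:: A]] names the one-block composition of [A], or the empty
    word when [A] is empty, so that one formula for [eps'] covers both cases. *)
Definition drop_empty (w : word) : word := [seq X <- w | X != fset0].
Definition restr (A : lset) (w : word) : word := drop_empty [seq A `&` X | X <- w].

(** * Unions and disjointness of blocks *)

Lemma disjP (A B : lset) : reflect (forall x, x \in A -> x \in B -> false) (disj A B).
Proof.
apply: (iffP (@fdisjointP _ A B)) => H x xA; first by rewrite (negPf (H x xA)).
by apply/negP => /(H x xA).
Qed.

Lemma disjC (A B : lset) : disj A B = disj B A.
Proof. exact: fdisjoint_sym. Qed.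

Lemma disjUr (A B C : lset) : disj A (B `|` C) = disj A B && disj A C.
Proof. exact: fdisjointXU. Qed.

Lemma disjUl (A B C : lset) : disj (B `|` C) A = disj B A && disj C A.
Proof. exact: fdisjointUX. Qed.

Lemma disj0l A : disj fset0 A. Proof. exact: fdisjoint0X. Qed.
Lemma disj0r A : disj A fset0. Proof. exact: fdisjointX0. Qed.

Lemma disjS (A B A' B' : lset) : A' `<=` A -> B' `<=` B -> disj A B -> disj A' B'.
Proof. by move=> /fsubsetP sA /fsubsetP sB /disjP d; apply/disjP => x /sA xA /sB; apply: d. Qed.

Lemma in_bigU (w : word) x : (x \in bigU w) = has (fun X : lset => x \in X) w.
Proof. by elim: w => [|X w IH]; rewrite /= ?inE // IH. Qed.

Lemma in_bigUP (w : word) x :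
  reflect (exists2 i, i < size w & x \in nth fset0 w i) (x \in bigU w).
Proof. by rewrite in_bigU; apply: (has_nthP fset0). Qed.

Lemma bigU_cat u v : bigU (u ++ v) = bigU u `|` bigU v.
Proof. by elim: u => [|X u IH] /=; rewrite ?fset0U // IH fsetUA. Qed.

Lemma bigU_drop_empty w : bigU (drop_empty w) = bigU w.
Proof. by elim: w => //= X w IH; case: eqVneq => [->|_] /=; rewrite IH ?fset0U. Qed.

Lemma bigU_setI A w : bigU [seq A `&` X | X <- w] = A `&` bigU w.
Proof. by elim: w => [|X w IH] /=; rewrite ?fsetI0 // IH fsetIUr. Qed.

Lemma bigU_restr A w : bigU (restr A w) = A `&` bigU w.
Proof. by rewrite bigU_drop_empty bigU_setI. Qed.

Lemma disj_bigU X w : disj X (bigU w) = all (disj X) w.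
Proof. by elim: w => [|Y w IH] /=; rewrite ?disj0r // disjUr IH. Qed.

Lemma bigU_eq0 w : all (fun X => X != fset0) w -> bigU w = fset0 -> w = [::].
Proof.
case: w => // X w /= /andP[/fset0Pn [x xX] _] /fsetP /(_ x).
by rewrite !inE xX.
Qed.

(** In this positional form an element determines the position of its block, which is how words are
    compared below. *)
Lemma is_compP A w : reflect
  [/\ forall i, i < size w -> nth fset0 w i != fset0,
      forall i j x, i < size w -> j < size w ->
        x \in nth fset0 w i -> x \in nth fset0 w j -> i = j &
      bigU w = A] (is_comp A w).
Proof.
rewrite /is_comp -andbA; apply: (iffP and3P) =>
  [[/all_nthP w0 /(pairwiseP fset0) wd /eqP wA]|[w0 wd wA]].
  split=> // [i|i j x iw jw xi xj]; first exact: w0.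
  apply/eqP; apply/negPn/negP; rewrite neq_ltn.
  by case/orP => [/(wd _ _ iw jw)|/(wd _ _ jw iw)] /disjP /(_ x); rewrite xi xj => /(_ isT isT).
split; [exact/(all_nthP fset0)| |exact/eqP].
apply/(pairwiseP fset0) => i j iw jw ij; apply/disjP => x xi xj.
by move: ij; rewrite (wd i j x iw jw xi xj) ltnn.
Qed.

Lemma is_comp_bigU A w : is_comp A w -> bigU w = A.
Proof. by case/is_compP. Qed.

Lemma is_comp_drop_empty w A : is_comp A w -> drop_empty w = w.
Proof. by case/andP => /andP[/all_filterP]. Qed.

Lemma is_comp_cat A w1 w2 : is_comp A (w1 ++ w2) =
  [&& is_comp (bigU w1) w1, is_comp (bigU w2) w2, disj (bigU w1) (bigU w2)
    & bigU w1 `|` bigU w2 == A].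
Proof.
rewrite /is_comp all_cat pairwise_cat bigU_cat !eqxx !andbT.
have -> : allrel disj w1 w2 = disj (bigU w1) (bigU w2).
  elim: w1 => [|X w IH]; first by rewrite /= disj0l.
  by rewrite allrel_consl /= disjUl IH (disj_bigU X).
by case: (all _ _); case: (all _ _); case: (disj _ _); case: (pairwise _ _); case: (pairwise _ _).
Qed.

Lemma pairwise_disj_setI A w : pairwise disj w -> pairwise disj [seq A `&` X | X <- w].
Proof.
rewrite pairwise_map; apply: sub_pairwise => X Y /=.
by apply: disjS; apply: fsubsetIr.
Qed.

Lemma is_comp_of_drop_empty w : pairwise disj w -> is_comp (bigU w) (drop_empty w).
Proof.
by move=> wd; rewrite /is_comp filter_all bigU_drop_empty eqxx andbT /= pairwise_filter.
Qed.

Lemma is_comp_restr A w : pairwise disj w -> is_comp (A `&` bigU w) (restr A w).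
Proof. by move=> /(pairwise_disj_setI A)/is_comp_of_drop_empty; rewrite bigU_setI. Qed.

Lemma restr_cons A X w : restr A (X :: w) =
  if A `&` X != fset0 then A `&` X :: restr A w else restr A w.
Proof. by []. Qed.

Lemma restr_drop_empty A w : restr A (drop_empty w) = restr A w.
Proof.
elim: w => // X w IH; rewrite restr_cons -IH /drop_empty /=.
by case: eqVneq => [->|_] /=; rewrite ?fsetI0 ?eqxx // restr_cons.
Qed.

Lemma restr_restr A B w : restr A (restr B w) = restr (A `&` B) w.
Proof.
rewrite {2}/restr restr_drop_empty /restr -map_comp; congr drop_empty.
by apply: eq_map => X /=; rewrite fsetIA.
Qed.

Lemma restr_id A w : is_comp A w -> restr A w = w.
Proof.
move=> wA; have /is_comp_bigU bA := wA.
rewrite /restr (_ : [seq _ | _ <- w] = w) ?(is_comp_drop_empty wA) //.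
rewrite -[RHS]map_id; apply/eq_in_map => X Xw; apply/fsetIidPr.
apply/fsubsetP => x xX; rewrite -bA in_bigU; apply/hasP; by exists X.
Qed.

Lemma restr_disj A w : disj A (bigU w) -> restr A w = [::].
Proof.
elim: w => // X w IH /=; rewrite disjUr => /andP[AX /IH]; rewrite /restr /= => ->.
by move: AX; rewrite /disj /fdisjoint => ->.
Qed.

(** The positions of [c] whose block meets [A] form a strictly increasing list with the same
    elements as [js], hence equal to [js]. In the application [js] lists the values of a
    quasi-shuffle on one of its two factors. *)
Lemma restr_sorted (A : lset) (a c : word) (js : seq nat) :
  sorted ltn js -> size js = size a -> all (fun j => j < size c) js ->
  (forall i, i < size a -> nth fset0 a i != fset0) ->
  (forall i, i < size a -> A `&` nth fset0 c (nth 0 js i) = nth fset0 a i) ->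
  (forall j, j < size c -> j \notin js -> A `&` nth fset0 c j = fset0) ->
  restr A c = a.
Proof.
move=> sjs szjs /allP jsc a0 ajs njs.
have -> : restr A c = [seq A `&` nth fset0 c j | j <- iota 0 (size c) &
                        A `&` nth fset0 c j != fset0].
  rewrite /restr -{1}[c](mkseq_nth fset0) /mkseq /drop_empty.
  by rewrite -map_comp filter_map.
have -> : [seq j <- iota 0 (size c) | A `&` nth fset0 c j != fset0] = js.
  apply: (irr_sorted_eq ltn_trans ltnn) => //.
    by apply: sorted_filter (iota_ltn_sorted _ _); apply: ltn_trans.
  move=> j; rewrite mem_filter mem_iota /= add0n.
  apply/andP/idP => [[j0 jc]|jjs].
    by apply: contraNT j0 => /(njs _ jc) ->.
  split; last exact: jsc.
  have ij : index j js < size a by rewrite -szjs index_mem.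
  by have := ajs _ ij; rewrite nth_index // => ->; apply: a0.
apply: (@eq_from_nth _ fset0); first by rewrite size_map.
by move=> i; rewrite size_map => ijs; rewrite (nth_map 0) // ajs // -szjs.
Qed.

(** * Images of set compositions under injections *)

Lemma bigU_img s w : bigU [seq img s X | X <- w] = img s (bigU w).
Proof.
elim: w => [|X w IH] /=; first by rewrite /img imfset0.
rewrite IH; apply/fsetP => x; rewrite inE; apply/orP/imfsetP => [[]|] /=.
- by case/imfsetP => y yX ->; exists y => //; rewrite inE yX.
- by case/imfsetP => y yX ->; exists y => //; rewrite inE yX orbT.
- by case=> y; rewrite inE => /orP[yX|yX] ->; [left|right]; apply: in_imfset.
Qed.

Lemma disj_img s A B : injon s (A `|` B) -> disj A B -> disj (img s A) (img s B).
Proof.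
move=> sAB /disjP AB; apply/disjP => _ /imfsetP[x /= xA ->] /imfsetP[y /= yB] /sAB.
by rewrite !inE xA yB orbT => /(_ isT isT) E; apply: (AB x) => //; rewrite E.
Qed.

Lemma injonS s A B : A `<=` B -> injon s B -> injon s A.
Proof. by move=> /fsubsetP AB sB x y /AB xB /AB yB; apply: sB. Qed.

Lemma pairwise_disj_img s w : injon s (bigU w) -> pairwise disj w ->
  pairwise disj [seq img s X | X <- w].
Proof.
elim: w => //= X w IH sXw; rewrite -!disj_bigU bigU_img => /andP[Xw wd].
by rewrite disj_img // IH //; apply: injonS sXw; apply: fsubsetUr.
Qed.

(** * Quasi-shuffles *)

Section QuasiShuffles.
Local Open Scope nat_scope.
Variables a b : word.
Hypothesis ab_comp : is_comp (bigU a `|` bigU b) (a ++ b).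
Notation n := (size a + size b)%N.
Notation t := (nth fset0 (a ++ b)).
Implicit Type sg : {ffun 'I_n -> 'I_n}.

Definition qsh_word sg : word :=
  [seq \big[fsetU/fset0]_(i : 'I_n | sg i == j :> nat) t i | j <- iota 0 (qsh_max sg)].

Let ab_disj : disj (bigU a) (bigU b).
Proof. by move: ab_comp; rewrite is_comp_cat => /and4P[]. Qed.

Let size_ab : size (a ++ b) = n. Proof. exact: size_cat. Qed.

Let t_neq0 (i : 'I_n) : t i != fset0.
Proof. by have /is_compP[h _ _] := ab_comp; apply: h; rewrite size_ab. Qed.

Let t_disj (i j : 'I_n) x : x \in t i -> x \in t j -> i = j.
Proof.
move=> xi xj; have /is_compP[_ h _] := ab_comp.
by apply: val_inj; apply: h xi xj; rewrite size_ab.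
Qed.

Lemma size_qsh_word sg : size (qsh_word sg) = qsh_max sg.
Proof. by rewrite size_map size_iota. Qed.

Lemma qsh_max_gt sg i : sg i < qsh_max sg.
Proof. exact: (leq_bigmax_cond (F := fun i => (sg i).+1)). Qed.

Lemma in_qsh_word sg j x : j < qsh_max sg ->
  reflect (exists2 i, sg i = j :> nat & x \in t i) (x \in nth fset0 (qsh_word sg) j).
Proof.
move=> jm; rewrite (nth_map 0) ?size_iota // nth_iota // add0n.
apply: (iffP (bigfcupP _ _ _ _)) => [[i /andP[_ /eqP ij] xi]|[i ij xi]]; exists i => //.
by rewrite mem_index_enum ij eqxx.
Qed.

(** The map [sg] can be read off its word: an element of the nonempty block [t i] lies in the block
    at position [sg i]. Hence every quasi-shuffle has multiplicity one. *)
Lemma qsh_word_inj : injective qsh_word.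
Proof.
move=> sg sg' E; apply/ffunP => i; apply: val_inj => /=.
have /fset0Pn[x xi] := t_neq0 i.
have : x \in nth fset0 (qsh_word sg) (sg i).
  by apply/in_qsh_word; [exact: qsh_max_gt|exists i].
have := qsh_max_gt sg i; rewrite -size_qsh_word E size_qsh_word => lt.
by case/(in_qsh_word _ lt) => i' <- /(t_disj xi) ->.
Qed.

(** Surjectivity makes the blocks nonempty, and disjointness is inherited from [a ++ b] because [sg]
    is a function. *)
Lemma qsh_word_comp sg : @is_qsh (size a) (size b) sg ->
  is_comp (bigU a `|` bigU b) (qsh_word sg).
Proof.
case/and3P => /forallP surj _ _; apply/is_compP; rewrite size_qsh_word; split.
- move=> j jm; have /fset0Pn : exists x, x \in nth fset0 (qsh_word sg) j; last by [].
  have jn : j < n by apply: leq_trans jm _; apply/bigmax_leqP.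
  have := surj (Ordinal jn); rewrite /= jm /= => /existsP[i /eqP ij].
  have /fset0Pn[x xi] := t_neq0 i; exists x.
  by apply/in_qsh_word => //; exists i; rewrite ?ij.
- move=> i j x im jm /(in_qsh_word _ im)[i' <- xi'] /(in_qsh_word _ jm)[j' <- xj'].
  by rewrite (t_disj xi' xj').
- rewrite -bigU_cat; apply/fsetP => x; apply/in_bigUP/in_bigUP.
    case=> j; rewrite size_qsh_word => jm /(in_qsh_word _ jm)[i _ xi].
    by exists i; rewrite ?size_ab.
  case=> i; rewrite size_ab => im xi; exists (sg (Ordinal im)).
    by rewrite size_qsh_word qsh_max_gt.
  by apply/in_qsh_word; [exact: qsh_max_gt|exists (Ordinal im)].
Qed.

Lemma nth_codom_ord sg (i : 'I_n) : nth 0 [seq val (sg i) | i <- enum 'I_n] i = sg i.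
Proof. by rewrite (nth_map i) ?size_enum_ord // nth_ord_enum. Qed.

(** The window of length [m] starting at [k] treats both factors at once: [k = 0] gives [a],
    [k = size a] gives [b]. Block [i] of [c] lands at position [sg (k + i)], and whatever is merged
    with it from outside the window is disjoint from [C]. *)
Lemma restr_qsh_word (k m : nat) (c : word) (C : lset) sg :
  (forall i i' : 'I_n, k <= i -> i < i' -> i' < k + m -> sg i < sg i') ->
  k + m <= n -> size c = m -> C = bigU c ->
  (forall i, i < m -> nth fset0 c i = t (k + i)) ->
  (forall i : 'I_n, (k <= i < k + m) = false -> disj C (t i)) ->
  restr C (qsh_word sg) = c.
Proof.
move=> mono kmn szc -> tc td.
(* Extends [sg] by 0 to all naturals, so that positions can be listed with [iota]. *)
pose s i := nth 0 [seq val (sg i) | i <- enum 'I_n] i.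
have sE (i : 'I_n) : s i = sg i by apply: nth_codom_ord.
have ilt i : i < m -> k + i < n by move=> im; apply: leq_trans kmn; rewrite ltn_add2l.
have cin i x : i < m -> x \in nth fset0 c i -> x \in bigU c.
  by move=> im xi; apply/in_bigUP; exists i; rewrite ?szc.
apply: (@restr_sorted _ _ _ [seq s (k + i) | i <- iota 0 m]).
- apply: (homo_sorted_in (P := fun i => i < m)) (iota_ltn_sorted 0 m); last first.
    by apply/allP => i; rewrite mem_iota.
  move=> i j; rewrite !unfold_in => im jm ij.
  rewrite (sE (Ordinal (ilt _ im))) (sE (Ordinal (ilt _ jm))).
  by apply: mono => /=; rewrite ?leq_addr ?ltn_add2l.
- by rewrite size_map size_iota szc.
- apply/allP => _ /mapP[i + ->]; rewrite mem_iota add0n => im.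
  by rewrite (sE (Ordinal (ilt _ im))) size_qsh_word qsh_max_gt.
- by move=> i; rewrite szc => im; rewrite tc //; apply: (t_neq0 (Ordinal (ilt _ im))).
- move=> i; rewrite szc => im.
  rewrite (nth_map 0) ?size_iota // nth_iota // add0n (sE (Ordinal (ilt _ im))).
  apply/fsetP => x; rewrite inE; apply/andP/idP => [[xc /in_qsh_word]|xi].
    case; first exact: qsh_max_gt.
    move=> i' E xi'.
    have [/andP[ki ikm]|] := boolP (k <= i' < k + m); last first.
      by move/negbTE => /td /disjP /(_ _ xc xi').
    suff -> : i = i' - k by rewrite tc ?subnKC // ltn_subLR.
    (* The two positions have the same image, and [sg] is strictly increasing on the window. *)
    have [lt|lt|E'] := ltngtP (i' : nat) (k + i).
    + by have := mono i' (Ordinal (ilt _ im)) ki lt; rewrite ltn_add2l E ltnn => /(_ im).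
    + by have := mono (Ordinal (ilt _ im)) i' (leq_addr _ _) lt ikm; rewrite E ltnn.
    + by rewrite E' addKn.
  split; first exact: cin xi.
  apply/in_qsh_word; first exact: qsh_max_gt.
  by exists (Ordinal (ilt _ im)) => //=; rewrite -tc.
- move=> j; rewrite size_qsh_word => jm jn.
  apply/fsetP => x; rewrite !inE; apply/andP => -[xc /(in_qsh_word _ jm)[i ij xi]].
  have [/andP[ki ikm]|] := boolP (k <= i < k + m); last first.
    by move/negbTE => /td /disjP /(_ _ xc xi).
  case/negP: jn; apply/mapP; exists (i - k).
    by rewrite mem_iota add0n ltn_subLR.
  by rewrite subnKC // sE.
Qed.

Lemma qsh_word_restr sg : @is_qsh (size a) (size b) sg ->
  restr (bigU a) (qsh_word sg) = a /\ restr (bigU b) (qsh_word sg) = b.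
Proof.
case/and3P => _ /forallP m1 /forallP m2; split.
- apply: (@restr_qsh_word 0 (size a)); rewrite ?leq_addr //.
  + move=> i i' _ ii' ik; have /forallP/(_ i') := m1 i.
    by rewrite ii' ik.
  + by move=> i ik; rewrite add0n nth_cat ik.
  + move=> i /= ik; rewrite nth_cat ik; apply: disjS ab_disj => //.
    apply/fsubsetP => x xi; apply/in_bigUP; exists (i - size a) => //.
    by rewrite ltn_subLR // leqNgt; apply/negbT.
- apply: (@restr_qsh_word (size a) (size b)) => //.
  + move=> i i' ki ii' ik; have /forallP/(_ i') := m2 i.
    by rewrite ki ii'.
  + by move=> i ik; rewrite nth_cat ltnNge leq_addr addKn.
  + move=> i; rewrite ltn_ord andbT => /negbT; rewrite -ltnNge => ik.
    rewrite nth_cat ik disjC; apply: disjS ab_disj => //.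
    by apply/fsubsetP => x xi; apply/in_bigUP; exists i.
Qed.

(** The quasi-shuffle sends the [i]-th block of [a] to the position of the [i]-th block of [c] that
    meets [bigU a], and likewise for [b]. *)
Lemma qsh_word_onto c : is_comp (bigU a `|` bigU b) c ->
  restr (bigU a) c = a -> restr (bigU b) c = b ->
  exists2 sg, @is_qsh (size a) (size b) sg & qsh_word sg = c.
Proof.
move=> c_comp ca cb.
have /is_compP[c0 cd cU] := c_comp.
pose js (A : lset) := [seq j <- iota 0 (size c) | A `&` nth fset0 c j != fset0].
have jsE A : restr A c = [seq A `&` nth fset0 c j | j <- js A].
  by rewrite /restr -{1}[c](mkseq_nth fset0) /mkseq /drop_empty -map_comp filter_map.
have jss A : sorted ltn (js A).
  by apply: sorted_filter (iota_ltn_sorted _ _); apply: ltn_trans.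
(* [S] is the list of values of the desired map. *)
pose S := js (bigU a) ++ js (bigU b).
have sza : size (js (bigU a)) = size a by rewrite -{2}ca jsE size_map.
have szb : size (js (bigU b)) = size b by rewrite -{2}cb jsE size_map.
have szS : size S = n by rewrite size_cat sza szb.
have Sc j : (j \in S) = (j < size c).
  rewrite mem_cat !mem_filter !mem_iota /= add0n -andb_orl.
  case: ltnP => jc; rewrite ?andbF // andbT.
  have /fset0Pn[x xj] := c0 _ jc.
  have : x \in bigU c by apply/in_bigUP; exists j.
  rewrite cU inE => /orP[xa|xb]; apply/orP; [left|right]; apply/fset0Pn; exists x;
    by rewrite inE ?xa ?xb.
(* The values must lie in ['I_n]: the list [S] has length [n] and contains every position of [c]. *)
have cn : size c <= n.
  rewrite -szS -(size_iota 0 (size c)); apply: uniq_leq_size (iota_uniq _ _) _ => j.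
  by rewrite mem_iota Sc.
have Sn (i : 'I_n) : nth 0 S i < n.
  by apply: leq_trans cn; rewrite -Sc mem_nth // szS.
pose sg : {ffun 'I_n -> 'I_n} := [ffun i => Ordinal (Sn i)].
have sgE i : sg i = nth 0 S i :> nat by rewrite ffunE.
have mx : qsh_max sg = size c.
  apply/eqP; rewrite eqn_leq; apply/andP; split.
    by apply/bigmax_leqP => i _; rewrite sgE -Sc mem_nth // szS.
  case E : (size c) => [|m] //.
  have mS : m \in S by rewrite Sc E.
  have iS : index m S < n by rewrite -szS index_mem.
  by have := qsh_max_gt sg (Ordinal iS); rewrite sgE /= nth_index.
have mono (u : seq nat) i j : sorted ltn u -> i < j -> j < size u -> nth 0 u i < nth 0 u j.
  move=> su ij ju; apply: (sorted_ltn_nth ltn_trans) => //; rewrite inE //.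
  exact: ltn_trans ju.
have tS (i : 'I_n) : t i = (if i < size a then bigU a else bigU b) `&` nth fset0 c (nth 0 S i).
  rewrite -{1}ca -{1}cb !jsE !nth_cat !size_map !sza.
  case: ltnP => ik; first by rewrite (nth_map 0) // sza.
  by rewrite (nth_map 0) // szb ltn_subLR.
exists sg.
  apply/and3P; split.
  - apply/forallP => j; apply/implyP; rewrite mx -Sc => jS; apply/existsP.
    have iS : index (val j) S < n by move: jS; rewrite -index_mem szS.
    by exists (Ordinal iS); apply/eqP; apply: val_inj; rewrite /= sgE /= nth_index.
  - apply/forallP => i; apply/forallP => i'; apply/implyP => /andP[ii' ik].
    rewrite !sgE !nth_cat sza ik (ltn_trans ii' ik); apply: mono => //.
    by rewrite sza.
  - apply/forallP => i; apply/forallP => i'; apply/implyP => /andP[ki ii'].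
    rewrite !sgE !nth_cat sza (ltnNge i) (ltnNge i') ki (leq_trans ki (ltnW ii')) /=.
    apply: mono => //; first by rewrite ltn_sub2r // (leq_ltn_trans ki).
    by rewrite szb ltn_subLR // (leq_trans ki (ltnW ii')).
apply: (@eq_from_nth _ fset0); rewrite size_qsh_word mx // => j jc.
apply/fsetP => x; apply/in_qsh_word/idP; rewrite ?mx //.
  by case=> i; rewrite sgE tS => ->; rewrite inE => /andP[].
move=> xj; have : x \in bigU c by apply/in_bigUP; exists j.
rewrite cU -bigU_cat => /in_bigUP[i]; rewrite size_ab => im xi.
exists (Ordinal im) => //; rewrite sgE.
have := tS (Ordinal im) => /= E; move: (xi); rewrite E inE => /andP[_ xS].
by apply: cd xS xj => //; rewrite -Sc mem_nth // szS.
Qed.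

(** Quasi-shuffle maps are traded for a condition on [c] alone, the only form in which the product
    is used afterwards. *)
Lemma count_qsh_words c :
  count_mem c (qsh_words a b) =
  [&& is_comp (bigU a `|` bigU b) c, restr (bigU a) c == a & restr (bigU b) c == b].
Proof.
have -> : qsh_words a b = [seq qsh_word sg | sg <- enum [pred sg | @is_qsh (size a) (size b) sg]].
  by [].
rewrite count_uniq_mem ?(map_inj_uniq qsh_word_inj) ?enum_uniq //; congr nat_of_bool.
apply/mapP/and3P => [[sg + ->]|[cc /eqP ca /eqP cb]].
  rewrite mem_enum inE => sgq; have [-> ->] := qsh_word_restr sgq.
  by split; rewrite ?eqxx //; apply: qsh_word_comp.
have [sg sgq <-] := qsh_word_onto cc ca cb.
by exists sg; rewrite ?mem_enum.
Qed.

End QuasiShuffles.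

(** * Cutting a word into pieces *)

Section Pieces.
Local Open Scope nat_scope.
Variable w : word.

Definition segment i j : word := take (j - i) (drop i w).

Lemma segmentE i j : segment i j = drop i (take j w).
Proof.
have [ij|ji] := leqP i j; first by rewrite /segment take_drop subnK.
rewrite /segment (eqP (ltnW ji)) take0 drop_oversize //.
by apply: leq_trans (ltnW ji); rewrite size_take_min geq_minl.
Qed.

(** As a [pairmap] over the sorted cuts, the pieces become accessible to induction on the list of
    cuts. *)
Lemma pieces_cut C : w != [::] ->
  pieces w C = pairmap segment 0 (rcons (sort leq C) (size w)).
Proof.
case: w segmentE => // X w' segE _; rewrite /pieces.
set l := rcons _ _; set w0 := X :: w' in segE *.
apply: (@eq_from_nth _ [::]); rewrite size_map size_iota ?size_pairmap // => i il.
by rewrite (nth_map 0) ?size_iota // nth_iota // add0n (nth_pairmap 0) // segE.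
Qed.

Lemma pieces0 C : w = [::] -> pieces w C = [::].
Proof. by rewrite /pieces => ->. Qed.

Lemma flatten_segments b l : path leq b l ->
  flatten (pairmap segment b l) = segment b (last b l).
Proof.
elim: l b => /= [|c l IH] b; first by rewrite /segment subnn take0.
case/andP => bc cl; rewrite IH // /segment.
have ce : c <= last c l.
  by elim: l c cl {IH bc} => //= d l IH c /andP[cd /IH]; apply: leq_trans.
have -> : drop c w = drop (c - b) (drop b w) by rewrite drop_drop subnK.
by rewrite -takeD addnC addnBA // subnK.
Qed.

Lemma size_segment i j : j <= size w -> size (segment i j) = j - i.
Proof. by move=> jw; rewrite size_takel // size_drop leq_sub2r. Qed.

(** Partial sums of the lengths of the pieces recover the cuts, which gives injectivity of
    cutting. *)
Lemma scanl_segments b l : path leq b l -> all (fun j => j <= size w) l ->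
  scanl addn b [seq size p | p <- pairmap segment b l] = l.
Proof.
elim: l b => //= c l IH b /andP[bc cl] /andP[cw lw].
by rewrite size_segment // subnKC // IH.
Qed.

Lemma segments_neq0 b l : path ltn b l -> all (fun j => j <= size w) l ->
  all (fun p => p != [::]) (pairmap segment b l).
Proof.
elim: l b => //= c l IH b /andP[bc cl] /andP[cw lw].
by rewrite IH // andbT -size_eq0 size_segment // -lt0n subn_gt0.
Qed.

(** The converse, giving surjectivity; the prefix [u] is the part already cut off, needed for the
    induction. *)
Lemma segments_scanl u ps : u ++ flatten ps = w ->
  pairmap segment (size u) (scanl addn (size u) [seq size p | p <- ps]) = ps.
Proof.
elim: ps u => //= p ps IH u E; congr (_ :: _).
  by rewrite /segment addKn -E drop_size_cat // take_size_cat.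
by rewrite -size_cat; apply: IH; rewrite -catA.
Qed.

Lemma path_scanl b (ps : seq word) : all (fun p => p != [::]) ps ->
  path ltn b (scanl addn b [seq size p | p <- ps]).
Proof.
elim: ps b => //= p ps IH b /andP[p0 ps0].
by rewrite IH // andbT -[X in X < _]addn0 ltn_add2l lt0n size_eq0.
Qed.

Lemma last_scanl b (ps : seq word) :
  last b (scanl addn b [seq size p | p <- ps]) = b + size (flatten ps).
Proof. by elim: ps b => [|p ps IH] b /=; rewrite ?addn0 // IH size_cat addnA. Qed.

Definition cut_set : pred {set 'I_(size w)} :=
  [pred C : {set 'I_(size w)} | [forall i, (i \in C) ==> (val i != 0)]].
Definition pieces_at (C : {set 'I_(size w)}) := pieces w [seq val i | i <- enum C].

Let cuts (C : {set 'I_(size w)}) := sort leq [seq val i | i <- enum C].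

Let mem_cuts C i : (val i \in cuts C) = (i \in C).
Proof. by rewrite mem_sort mem_map ?mem_enum //; apply: val_inj. Qed.

Let path_cuts C : cut_set C -> w != [::] -> path ltn 0 (rcons (cuts C) (size w)).
Proof.
move=> /forallP C0 w0; have allC : all (fun j => 0 < j < size w) (cuts C).
  apply/allP => j; rewrite mem_sort => /mapP[i + ->]; rewrite mem_enum => iC.
  by rewrite ltn_ord andbT lt0n; have := C0 i; rewrite iC.
rewrite rcons_path; apply/andP; split.
  rewrite path_min_sorted; last by apply/allP => j /(allP allC) /andP[].
  rewrite ltn_sorted_uniq_leq sort_uniq map_inj_uniq ?enum_uniq; last exact: val_inj.
  by apply: sort_sorted leq_total _.
have : last 0 (cuts C) \in 0 :: cuts C by apply: mem_last.
by rewrite inE => /orP[/eqP ->|/(allP allC)/andP[]//]; rewrite /= lt0n size_eq0.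
Qed.

Let cuts_le C : all (fun j => j <= size w) (rcons (cuts C) (size w)).
Proof.
rewrite all_rcons leqnn /=.
by apply/allP => j; rewrite mem_sort => /mapP[i _ ->] /=; apply: ltnW.
Qed.

Let ltn_path_leq b l : path ltn b l -> path leq b l.
Proof. by move=> bl; apply: sub_path bl => i j /ltnW. Qed.

Lemma pieces_at_split C : cut_set C ->
  flatten (pieces_at C) = w /\ all (fun p => p != [::]) (pieces_at C).
Proof.
move=> C0; rewrite /pieces_at; have [w0|w0] := eqVneq w [::]; first by rewrite pieces0.
rewrite pieces_cut // flatten_segments ?ltn_path_leq ?path_cuts //.
rewrite segments_neq0 ?path_cuts ?cuts_le //.
by rewrite last_rcons /segment subn0 drop0 take_size.
Qed.

Lemma pieces_at_inj : {in cut_set &, injective pieces_at}.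
Proof.
move=> C D C0 D0; have [w0 _|w0] := eqVneq w [::].
  (* For the empty word ['I_(size w)] is empty, so there is only one set of cuts. *)
  by apply/setP => i; have := ltn_ord i; rewrite [X in _ < X -> _](f_equal size w0).
rewrite /pieces_at !pieces_cut // => /(congr1 (fun l => scanl addn 0 [seq size p | p <- l])).
rewrite !scanl_segments ?ltn_path_leq ?path_cuts ?cuts_le // => /rcons_inj[E].
by apply/setP => i; rewrite -!mem_cuts /cuts E.
Qed.

Lemma pieces_at_onto ps : flatten ps = w -> all (fun p => p != [::]) ps ->
  exists2 C, cut_set C & pieces_at C = ps.
Proof.
move=> E ps0; have [w0|w0] := eqVneq w [::].
  exists set0; first by apply/forallP => i; rewrite inE.
  rewrite /pieces_at pieces0 //; case: ps ps0 E => [|[|X p] ps] //=.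
  by move=> _ E; rewrite -E in w0.
(* The last partial sum is [size w]; those before it are the cuts. *)
have := segments_scanl (u := [::]) E; have := path_scanl 0 ps0; have := last_scanl 0 ps.
rewrite E add0n; case/lastP: (scanl _ _ _) => [/esym/eqP|l e]; first by rewrite size_eq0 (negPf w0).
rewrite last_rcons => -> lp psE.
have [sl lw l0] : [/\ sorted ltn l, all (fun j => j < size w) l & 0 \notin l].
  split.
  - by move: lp; rewrite rcons_path => /andP[/path_sorted].
  - have : sorted ltn (rcons l (size w)) by apply: path_sorted lp.
    by rewrite (sorted_pairwise ltn_trans) pairwise_rcons => /andP[].
  - move: lp; rewrite (path_sortedE ltn_trans) all_rcons.
    by case/andP => /andP[_ /allP h] _; apply/negP => /h.
pose C := [set i : 'I_(size w) | val i \in l].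
exists C; first by apply/forallP => i; rewrite inE; apply/implyP; apply: contraL => /eqP ->.
rewrite /pieces_at pieces_cut // (_ : sort _ _ = l) //.
apply: (irr_sorted_eq ltn_trans ltnn) => //.
  rewrite ltn_sorted_uniq_leq sort_uniq map_inj_uniq ?enum_uniq; last exact: val_inj.
  by apply: sort_sorted leq_total _.
move=> j; rewrite mem_sort; apply/mapP/idP => [[i + ->]|jl]; first by rewrite mem_enum inE.
by exists (Ordinal (allP lw _ jl)); rewrite ?mem_enum ?inE.
Qed.

(** Cut sets correspond one to one to factorizations of [w] into nonempty words, so a sum over cut
    sets reduces to a condition on [ps]. *)
Lemma count_pieces ps : count_mem ps [seq pieces_at C | C <- enum cut_set] =
  (flatten ps == w) && all (fun p => p != [::]) ps.
Proof.
rewrite count_uniq_mem; last first.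
  rewrite map_inj_in_uniq ?enum_uniq // => C D; rewrite !mem_enum; exact: pieces_at_inj.
congr nat_of_bool; apply/mapP/andP => [[C + ->]|[/eqP E ps0]].
  by rewrite mem_enum => /pieces_at_split[-> ->].
by have [C C0 <-] := pieces_at_onto E ps0; exists C; rewrite ?mem_enum.
Qed.

End Pieces.

Local Open Scope ring_scope.

(** * Functionals on subspaces *)

Section LinearOnSubspaces.
Variables (K : fieldType) (V : lmodType K).

Definition subspace (W : {pred V}) : Prop :=
  0 \in W /\ forall (a : K) x y, x \in W -> y \in W -> a *: x + y \in W.

Definition lin_on (W : {pred V}) (f : V -> K) : Prop :=
  forall (a : K) x y, x \in W -> y \in W -> f (a *: x + y) = a * f x + f y.

Lemma lin_on0 W f : subspace W -> lin_on W f -> f 0 = 0.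
Proof.
move=> [W0 _] fl; have := fl (-1) 0 0 W0 W0.
by rewrite scaler0 addr0 mulN1r addNr.
Qed.

Lemma lin_onZ W f a x : subspace W -> lin_on W f -> x \in W -> f (a *: x) = a * f x.
Proof.
move=> Ws fl Wx; have := fl a x 0 Wx Ws.1.
by rewrite !addr0 (lin_on0 Ws fl) addr0.
Qed.

Lemma lin_on_sum W f (I : eqType) (s : seq I) (c : I -> K) (x : I -> V) :
  subspace W -> lin_on W f -> (forall i, i \in s -> x i \in W) ->
  f (\sum_(i <- s) c i *: x i) = \sum_(i <- s) c i * f (x i).
Proof.
move=> Ws fl; elim: s => [|i s IH] Wx; first by rewrite !big_nil (lin_on0 Ws fl).
have Ws' j : j \in s -> x j \in W by move=> js; apply: Wx; rewrite inE js orbT.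
rewrite !big_cons fl ?IH //; first by apply: Wx; rewrite inE eqxx.
elim: s Ws' {IH Wx} => [|j s IH] Wx; first by rewrite big_nil Ws.1.
rewrite big_cons; apply: Ws.2; first by apply: Wx; rewrite inE eqxx.
by apply: IH => k ks; apply: Wx; rewrite inE ks orbT.
Qed.

(** Zorn's lemma applied to graphs of partial linear functionals on [V] that extend [f]; a maximal
    one is defined everywhere. *)
Lemma lin_on_extend W f : subspace W -> lin_on W f ->
  exists g : {scalar V}, {in W, g =1 f}.
Proof.
move=> Ws fl.
pose lin (G : set (V * K)) := forall (a : K) x y k l,
  G (x, k) -> G (y, l) -> G (a *: x + y, a * k + l).
pose Gf : set (V * K) := fun p => p.1 \in W /\ p.2 = f p.1.
(* Containing [Gf] is demanded only of nonempty [G]: the union of an empty chain is empty and must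
   satisfy [Q]. *)
pose Q (G : set (V * K)) := [/\ lin G, (forall k, G (0, k) -> k = 0) &
  forall p, G p -> forall q, Gf q -> G q].
have QGf : Q Gf.
  split=> // [a x y k l [/= Wx ->] [/= Wy ->]|k [/= _ ->]].
    by split; rewrite /= ?fl //; apply: Ws.2.
  exact: lin_on0 Ws fl.
have [|G [[Gl G0 Gsub] Gmax]] := @Zorn_bigcup _ Q.
  move=> F FQ Ftot; split.
  - move=> a x y k l [X FX Xx] [Y FY Yy].
    have [XY|YX] := Ftot X Y FX FY.
      by exists Y => //; have [Yl _ _] := FQ Y FY; apply: Yl => //; apply: XY.
    by exists X => //; have [Xl _ _] := FQ X FX; apply: Xl => //; apply: YX.
  - by move=> k [X FX Xk]; have [_ X0 _] := FQ X FX; apply: X0.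
  - move=> p [X FX Xp] q qf; exists X => //.
    by have [_ _ Xs] := FQ X FX; apply: Xs Xp q qf.
have Gf0 : Gf (0, 0) by split; rewrite /= ?(lin_on0 Ws fl) ?Ws.1.
have GfG : forall q, Gf q -> G q.
  (* A maximal [G] is nonempty, for otherwise [Gf] would be strictly larger. *)
  move=> q qf; have [[p Gp]|Ge] := pselect (exists p, G p).
    exact: Gsub Gp q qf.
  by case: (Gmax Gf) => //; split=> [p Gp|/(_ _ Gf0) G00]; case: Ge; [exists p|exists (0, 0)].
have G00 := GfG _ Gf0.
have Guniq x k l : G (x, k) -> G (x, l) -> k = l.
  move=> xk xl; have := Gl (-1) _ _ _ _ xk xl.
  rewrite scaleN1r addNr mulN1r => /G0 /eqP.
  by rewrite addrC subr_eq0 eq_sym => /eqP.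
have Gtot x : exists k, G (x, k).
  have [//|xG] := pselect (exists k, G (x, k)).
  (* If [x] is outside the domain of [G], then [H] extends [G] strictly by sending [x] to 0. *)
  pose H : set (V * K) := fun p => exists y c, p.1 = y + c *: x /\ G (y, p.2).
  have GH : forall p, G p -> H p.
    by move=> [y k] yk; exists y, 0; rewrite scale0r addr0.
  case: (Gmax H).
    split=> // /(_ (x, 0)) HG; apply: xG; exists 0; apply: HG.
    by exists 0, 1; rewrite /= scale1r add0r.
  split.
  - move=> a y z k l [y' [c [/= -> yk]]] [z' [d [/= -> zl]]].
    exists (a *: y' + z'), (a * c + d); split; last exact: Gl.
    by rewrite scalerDr scalerDl scalerA addrACA.
  - move=> k [y [c [/= /esym/eqP]]]; rewrite addr_eq0 => /eqP ->.
    (* With [c != 0], the vector [x] would be a multiple of an element of the domain of [G]. *)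
    have [->|c0] := eqVneq c 0; first by rewrite scale0r oppr0; apply: G0.
    rewrite -scaleNr => Gk; case: xG; exists ((- c)^-1 * k + 0).
    have := Gl (- c)^-1 _ _ _ _ Gk G00.
    by rewrite addr0 scalerA mulVf ?oppr_eq0 // scale1r.
  - by move=> _ _ q /GfG /GH.
pose g x : K := sval (cid (Gtot x)).
have gP x : G (x, g x) by rewrite /g; case: cid.
have gl : linear_for *%R g by move=> a x y; apply: Guniq (gP _) _; apply: Gl.
pose gL := GRing.isLinear.Build K V K *%R g gl.
pose gS : {scalar V} := HB.pack g gL.
exists gS => x Wx /=; apply: Guniq (gP x) _.
by apply: GfG.
Qed.

(** [teq2] and [teq3] only test functionals defined on all of [V], whence the extension. *)
Lemma teq2_lin_on W1 W2 f1 f2 (s t : seq (V * V)) :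
  subspace W1 -> subspace W2 -> lin_on W1 f1 -> lin_on W2 f2 ->
  all (fun p => (p.1 \in W1) && (p.2 \in W2)) s ->
  all (fun p => (p.1 \in W1) && (p.2 \in W2)) t -> teq2 s t ->
  \sum_(p <- s) f1 p.1 * f2 p.2 = \sum_(p <- t) f1 p.1 * f2 p.2.
Proof.
move=> W1s W2s f1l f2l /allP sW /allP tW st.
have [g1 g1E] := lin_on_extend W1s f1l; have [g2 g2E] := lin_on_extend W2s f2l.
have := st g1 g2; rewrite /teval2 => E.
transitivity (\sum_(p <- s) g1 p.1 * g2 p.2).
  by apply: eq_big_seq => p /sW /andP[p1 p2]; rewrite g1E ?g2E.
by rewrite E; apply: eq_big_seq => p /tW /andP[p1 p2]; rewrite g1E ?g2E.
Qed.

Lemma teq3_lin_on W1 W2 W3 f1 f2 f3 (s t : seq (V * V * V)) :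
  subspace W1 -> subspace W2 -> subspace W3 ->
  lin_on W1 f1 -> lin_on W2 f2 -> lin_on W3 f3 ->
  (forall p, p \in s -> [/\ p.1.1 \in W1, p.1.2 \in W2 & p.2 \in W3]) ->
  (forall p, p \in t -> [/\ p.1.1 \in W1, p.1.2 \in W2 & p.2 \in W3]) -> teq3 s t ->
  \sum_(p <- s) f1 p.1.1 * f2 p.1.2 * f3 p.2 = \sum_(p <- t) f1 p.1.1 * f2 p.1.2 * f3 p.2.
Proof.
move=> W1s W2s W3s f1l f2l f3l sW tW st.
have [g1 g1E] := lin_on_extend W1s f1l; have [g2 g2E] := lin_on_extend W2s f2l.
have [g3 g3E] := lin_on_extend W3s f3l.
have := st g1 g2 g3; rewrite /teval3 => E.
transitivity (\sum_(p <- s) g1 p.1.1 * g2 p.1.2 * g3 p.2).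
  by apply: eq_big_seq => p /sW [p1 p2 p3]; rewrite g1E ?g2E ?g3E.
by rewrite E; apply: eq_big_seq => p /tW [p1 p2 p3]; rewrite g1E ?g2E ?g3E.
Qed.

Lemma sum_tscale W f g a (s : seq (V * V)) : subspace W -> lin_on W f ->
  (forall p, p \in s -> p.1 \in W) ->
  \sum_(p <- tscale a s) f p.1 * g p.2 = a * \sum_(p <- s) f p.1 * g p.2.
Proof.
move=> Ws fl sW; rewrite big_map mulr_sumr; apply: eq_big_seq => p /sW pW /=.
by rewrite (lin_onZ _ Ws fl) // mulrA.
Qed.

End LinearOnSubspaces.

(** * Coefficients of the operations of Comp *)

(** By injectivity on [A], blockwise preimage inverts blockwise image. This identifies the only word
    that relabelling can send to [c]. *)
Lemma img_word_eq s A (w c : word) : injon s A -> is_comp A w ->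
  ([seq img s X | X <- w] == c) =
  is_comp (img s A) c && (w == [seq [fset x in A | s x \in X] | X <- c]).
Proof.
move=> sA wA.
have [/andP[/allP w0 wd] wU] : all (fun X => X != fset0) w && pairwise disj w /\ bigU w = A.
  by case/andP: wA => ? /eqP.
have wsub X : X \in w -> X `<=` A.
  move=> Xw; apply/fsubsetP => x xX; rewrite -wU in_bigU; apply/hasP; by exists X.
apply/eqP/andP => [<-|[cA /eqP ->]].
  split.
    rewrite /is_comp bigU_img wU eqxx andbT; apply/andP; split.
      apply/allP => _ /mapP[X /w0 /fset0Pn[x xX] ->]; apply/fset0Pn; exists (s x).
      exact: in_imfset.
    rewrite pairwise_map; apply: (sub_in_pairwise (P := [in w])) wd; last exact/allP.
    move=> X Y; rewrite /= => Xw Yw XY.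
    apply/disjP => _ /imfsetP[x /= xX ->] /imfsetP[y /= yY] /sA E.
    have E' : x = y by apply: E; [apply: (fsubsetP (wsub X Xw))|apply: (fsubsetP (wsub Y Yw))].
    by apply: (disjP _ _ XY x xX); rewrite E'.
  apply/eqP; rewrite -map_comp -[LHS]map_id; apply/eq_in_map => X Xw /=.
  apply/fsetP => x; rewrite !inE /=; apply/idP/andP => [xX|[xA /imfsetP[y /= yX /sA ->]] //].
    by split; [apply: (fsubsetP (wsub _ Xw))|apply: in_imfset].
  by rewrite (fsubsetP (wsub _ Xw)).
rewrite -map_comp; apply: map_id_in => X Xc /=.
have /fsubsetP XA : X `<=` img s A.
  rewrite -(is_comp_bigU cA); apply/fsubsetP => x xX; rewrite in_bigU; apply/hasP; by exists X.
apply/fsetP => x; apply/imfsetP/idP => [[y /=]|xX]; first by rewrite !inE => /andP[_ ?] ->.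
have /imfsetP[y /= yA E] := XA _ xX.
by exists y => //; rewrite !inE yA -E.
Qed.

Lemma is_comp_map_bigU A ps : is_comp A (flatten ps) ->
  all (fun p => p != [::]) ps -> is_comp A [seq bigU p | p <- ps].
Proof.
elim: ps A => //= p ps IH A; rewrite is_comp_cat => /and4P[pA /IH{}IH d /eqP <-] /andP[p0 /IH].
case/andP => /andP[psn psd] /eqP psU.
rewrite /is_comp /= psn psd psU eqxx !andbT; apply/andP; split.
  by case/andP: pA => /andP[pn _] _; apply: contraNneq p0 => /(bigU_eq0 pn) ->.
by rewrite -disj_bigU psU.
Qed.

Section Coefficients.
Variable K : fieldType.
Implicit Types u v : fs K.

(** With indicators in place of a filter, conditions multiply and sums can be factored. *)
Lemma coefE u c : coef u c = \sum_(p <- u) p.1 * (p.2 == c)%:R.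
Proof.
by rewrite /coef big_mkcond; apply: eq_bigr => p _; case: eqP; rewrite ?mulr1 ?mulr0.
Qed.

Lemma coef2E (u : fs2 K) c : coef2 u c = \sum_(p <- u) p.1 * (p.2 == c)%:R.
Proof.
by rewrite /coef2 big_mkcond; apply: eq_bigr => p _; case: eqP; rewrite ?mulr1 ?mulr0.
Qed.

Definition supp_comp A u : bool := all (fun p : K * word => is_comp A p.2) u.

Lemma coef_supp A u c : supp_comp A u -> ~~ is_comp A c -> coef u c = 0.
Proof.
move=> /allP uA cA; rewrite coefE big1_seq // => p /andP[_ /uA pA].
by case: eqP cA => [<-|]; rewrite ?pA // mulr0.
Qed.

Lemma sum_count (T : eqType) (s : seq T) c :
  \sum_(x <- s) (x == c)%:R = (count_mem c s)%:R :> K.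
Proof. by rewrite -sum1_count natr_sum [in RHS]big_mkcond; apply: eq_bigr => x _ /=; case: eqP. Qed.

(** A pair of words contributes to [c] only if they are its two restrictions, and then exactly once,
    so the double sum factors. *)
Lemma coef_fs_mul A B u v c : disj A B -> supp_comp A u -> supp_comp B v ->
  coef (fs_mul u v) c =
  (is_comp (A `|` B) c)%:R * coef u (restr A c) * coef v (restr B c).
Proof.
move=> AB /allP uA /allP vB.
rewrite coefE /fs_mul big_flatten big_allpairs_dep /= [coef u _]coefE mulr_sumr mulr_suml.
apply: eq_big_seq => p /uA pA; rewrite [coef v _]coefE mulr_sumr.
apply: eq_big_seq => q /vB qB; rewrite big_map /= -mulr_sumr sum_count.
have [pU qU] := (is_comp_bigU pA, is_comp_bigU qB).
rewrite count_qsh_words; last first.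
  by rewrite is_comp_cat pU qU pA qB AB eqxx.
rewrite pU qU [p.2 == _]eq_sym [q.2 == _]eq_sym.
case: (is_comp _ c); rewrite ?mul0r ?mulr0 // mul1r /=.
by case: eqP => _; case: eqP => _ /=; rewrite ?mulr0 ?mulr1 ?mul0r.
Qed.

Lemma supp_fs_mul A B u v : disj A B -> supp_comp A u -> supp_comp B v ->
  supp_comp (A `|` B) (fs_mul u v).
Proof.
move=> AB /allP uA /allP vB; apply/allP => r /flattenP[s /allpairsP[[p q] /= [pu qv ->]]].
case/mapP => w + -> /=; have [pA qB] := (uA _ pu, vB _ qv).
have [pU qU] := (is_comp_bigU pA, is_comp_bigU qB).
rewrite -has_pred1 has_count count_qsh_words ?is_comp_cat pU qU ?pA ?qB ?AB ?eqxx //.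
by case: (is_comp _ w).
Qed.

Lemma coef_fs_act s A u c : injon s A -> supp_comp A u ->
  coef (fs_act s u) c =
  (is_comp (img s A) c)%:R * coef u [seq [fset x in A | s x \in X] | X <- c].
Proof.
move=> sA /allP uA; rewrite !coefE big_map mulr_sumr; apply: eq_big_seq => p /uA pA /=.
rewrite mulrCA -natrM mulnb; congr (_ * (nat_of_bool _)%:R).
exact: img_word_eq.
Qed.

(** A composition of [A] with at most one block is [[:: A]], or empty if [A] is. *)
Lemma coef_comp_eps' A u : supp_comp A u -> comp_eps' u = coef u (drop_empty [:: A]).
Proof.
move=> /allP uA; rewrite /comp_eps' coefE; apply: eq_big_seq => p /uA.
case: p => a w /= wA; congr (_ * (nat_of_bool _)%:R).
have /is_comp_bigU wU := wA; have /is_comp_drop_empty wn := wA.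
apply/idP/eqP => [|->]; last by case: ifP.
case: w wA wU wn => [|X [|]] //= wA <- wn _; rewrite ?eqxx // fsetU0.
by move: wn; rewrite /drop_empty /=; case: ifP.
Qed.

Lemma coef_comp_Delta A B u c d : disj A B -> supp_comp (A `|` B) u ->
  coef2 (comp_Delta A B u) (c, d) = (bigU c == A)%:R * coef u (c ++ d).
Proof.
move=> AB /allP uA; rewrite coef2E big_flatten big_map coefE mulr_sumr.
apply: eq_big_seq => -[a w] /uA wA; rewrite big_map big_filter.
rewrite -[(a, w).1]/a -[(a, w).2]/w in wA *.
(* Only the cut at [i = size c] can produce [(c, d)], and it does so for [w = c ++ d]. *)
transitivity (\sum_(i <- iota 0 (size w).+1)
    (i == size c)%:R * (a * ((bigU c == A) && (w == c ++ d))%:R)).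
  rewrite big_mkcond; apply: eq_big_seq => i; rewrite mem_iota /= add0n ltnS => iw.
  rewrite mulrCA -natrM mulnb -[if _ then _ else _](_ :
    a * ((bigU (take i w) == A) && ((take i w, drop i w) == (c, d)))%:R = _); last first.
    by case: eqP; rewrite ?mulr0.
  congr (_ * (nat_of_bool _)%:R); case: (eqVneq i (size c)) => [->|ic] /=; last first.
    case: eqP => // _; case: eqP => // -[ E _]; case/eqP: ic.
    by rewrite -E size_takel.
  have [->|wcd] := eqVneq w (c ++ d).
    by rewrite take_size_cat // drop_size_cat // eqxx andbT; case: eqP.
  rewrite andbF; case: eqP => // _; case: eqP => // -[E1 E2]; case/eqP: wcd.
  by rewrite -(cat_take_drop (size c) w) E1 E2.
rewrite -mulr_suml sum_count mulrCA [RHS]mulrCA -!natrM mulnb; congr (_ * _%:R).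
have [->|] := eqVneq w (c ++ d); rewrite ?andbF ?muln0 // andbT.
by rewrite count_uniq_mem ?iota_uniq // mem_iota add0n ltnS size_cat /= leq_addr mul1n.
Qed.

Lemma supp_fs_prod ps : is_comp (bigU (flatten ps)) (flatten ps) ->
  supp_comp (bigU (flatten ps)) (fs_prod K ps).
Proof.
elim: ps => [|p ps IH]; first by rewrite /= /fs_unit /supp_comp /= /is_comp /= eqxx.
rewrite /= is_comp_cat => /and4P[pc psc d _].
by rewrite bigU_cat; apply: supp_fs_mul => //; [rewrite /supp_comp /= pc|apply: IH].
Qed.

Lemma coef_fs_prod ps c : is_comp (bigU (flatten ps)) (flatten ps) ->
  coef (fs_prod K ps) c =
  (is_comp (bigU (flatten ps)) c && all (fun p => restr (bigU p) c == p) ps)%:R.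
Proof.
elim: ps c => [|p ps IH] c.
  move=> _; rewrite coefE /= big_seq1 mul1r andbT eq_sym /is_comp; congr (nat_of_bool _)%:R.
  case: c => [|X c] //=; apply/esym/negP => /andP[/andP[/andP[X0 _] _]].
  by rewrite fsetU_eq0 (negPf X0).
rewrite /= is_comp_cat => /and4P[pc psc d _].
rewrite (coef_fs_mul (A := bigU p) (B := bigU (flatten ps))) //; last first.
- exact: supp_fs_prod.
- by rewrite /supp_comp /= pc.
rewrite bigU_cat; case cc: (is_comp _ c); rewrite ?mul0r // mul1r IH //.
rewrite coefE big_seq1 mul1r eq_sym /=.
have -> : is_comp (bigU (flatten ps)) (restr (bigU (flatten ps)) c).
  have [cd cU] : pairwise disj c /\ bigU c = bigU p `|` bigU (flatten ps).
    by case/andP: cc => /andP[_ ?] /eqP.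
  by have := is_comp_restr (bigU (flatten ps)) cd; rewrite cU (fsetIidPl _) // fsubsetUr.
rewrite -natrM mulnb /=; congr (nat_of_bool (_ && _))%:R.
(* Each later piece lies in [bigU (flatten ps)], so restricting [c] there first changes nothing. *)
apply: eq_in_all => q qps; rewrite restr_restr (fsetIidPl _) //.
apply/fsubsetP => x xq; rewrite in_bigU; move: xq; rewrite in_bigU => /hasP[X Xq xX].
by apply/hasP; exists X => //; apply/flattenP; exists q.
Qed.

(** The pair [(c, d)] determines the pieces: the one merged into the block [X] of [c] must be
    [restr X d]. Hence at most one cut set contributes, and [w] is the refinement of [c] by [d]. *)
Lemma coef_comp_delta_word A w c d : is_comp A w ->
  coef2 (comp_delta_word K w) (c, d) =
  [&& is_comp A c, is_comp A d & w == flatten [seq restr X d | X <- c]]%:R.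
Proof.
move=> wA; set ps0 := [seq restr X d | X <- c].
transitivity (\sum_(C <- enum (@cut_set w))
    (is_comp A d && (c == [seq bigU X | X <- ps0]))%:R * (pieces_at C == ps0)%:R : K).
  rewrite coef2E big_flatten big_map; apply: eq_big_seq => C.
  rewrite mem_enum => /pieces_at_split[+ _]; rewrite /pieces_at.
  set ps := pieces w _ => fE; rewrite big_map /=.
  transitivity ((c == [seq bigU X | X <- ps])%:R * coef (fs_prod K ps) d).
    rewrite coefE mulr_sumr; apply: eq_bigr => q _.
    by rewrite mulrCA -natrM mulnb -pair_eqE /= [c == _]eq_sym.
  rewrite coef_fs_prod fE (is_comp_bigU wA) // -!natrM !mulnb; congr (nat_of_bool _)%:R.
  rewrite andbCA -andbA; congr (_ && _).
  (* Once [c] lists the unions of the pieces, asking [d] to restrict to every piece says that [ps]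
     is [ps0]. *)
  have [E|cps] := eqVneq c [seq bigU X | X <- ps].
    have -> : ps0 = [seq restr (bigU p) d | p <- ps] by rewrite /ps0 E -map_comp.
    have -> : all (fun p => restr (bigU p) d == p) ps = (ps == [seq restr (bigU p) d | p <- ps]).
      elim: (ps) => //= p ps1 IH.
      by rewrite IH [restr _ _ == _]eq_sym eqseq_cons.
    by case: eqP => [<-|]; rewrite ?andbF // andbT E eqxx.
  by case: (ps =P ps0) cps => [->|_] cps; rewrite ?andbF // (negPf cps).
rewrite -mulr_sumr -(big_map (@pieces_at w) xpredT (fun ps => (ps == ps0)%:R)) sum_count.
rewrite count_pieces -natrM mulnb; congr (nat_of_bool _)%:R.
have [dA|_] /= := boolP (is_comp A d); last by rewrite andbF.
rewrite [w == _]eq_sym; apply/and3P/andP => [[/eqP cE /eqP wE ps0n]|[cA /eqP wE]]; split.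
- by rewrite cE; apply: is_comp_map_bigU => //; rewrite wE.
- by rewrite wE.
- have cU X : X \in c -> X `<=` A.
    move=> Xc; rewrite -(is_comp_bigU cA); apply/fsubsetP => x xX.
    by rewrite in_bigU; apply/hasP; exists X.
  apply/eqP; rewrite /ps0 -map_comp; apply/esym/map_id_in => X Xc /=.
  by rewrite bigU_restr (is_comp_bigU dA) (fsetIidPl (cU X Xc)).
- by rewrite wE.
(* A block of [c] is nonempty and covered by [d], so the restriction of [d] to it is nonempty. *)
- apply/allP => _ /mapP[X Xc ->]; apply/negP => /eqP E.
  have /allP/(_ X Xc)/fset0Pn[x xX] : all (fun X => X != fset0) c by case/andP: cA => /andP[].
  have : x \in bigU (restr X d); last by rewrite E.
  rewrite bigU_restr (is_comp_bigU dA) inE xX -(is_comp_bigU cA) in_bigU.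
  by apply/hasP; exists X.
Qed.

Lemma coef_comp_delta A u c d : supp_comp A u ->
  coef2 (comp_delta u) (c, d) =
  (is_comp A c && is_comp A d)%:R * coef u (flatten [seq restr X d | X <- c]).
Proof.
move=> /allP uA; rewrite coef2E big_flatten big_map coefE mulr_sumr.
apply: eq_big_seq => p /uA pA; rewrite big_map /=.
under eq_bigr do rewrite -mulrA.
rewrite -mulr_sumr -coef2E (coef_comp_delta_word _ _ pA).
by case: (_ c); case: (_ d); case: eqP; rewrite ?mulr0 ?mul0r ?mulr1 ?mul1r.
Qed.

End Coefficients.

(** * Iterated coproducts of functionals *)

Section IteratedCoproducts.
Variables (K : fieldType) (P : dtb_data K).
Hypothesis HP : is_dtb P.
Implicit Types (f g : charf P) (A B C X : lset) (w : word).

Lemma Psub_subspace A : subspace (Psub P A).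
Proof. by split; [apply: (sub_0 HP)|apply: (sub_lin HP)]. Qed.
Hint Resolve Psub_subspace : core.

Definition lin_fam f : Prop := forall A, lin_on (Psub P A) (f A).

Definition conv A B (f1 f2 : PV P -> K) (x : PV P) : K :=
  \sum_(p <- PDelta P A B x) f1 p.1 * f2 p.2.

(** [(f (x) ... (x) f) o Delta_(X1,...,Xk)] for [w = [:: X1; ...; Xk]]; blocks of [w] may be empty. *)
Fixpoint iconv f w : PV P -> K :=
  if w is X :: w' then conv X (bigU w') (f X) (iconv f w') else Peps P.

Lemma PDelta_mem A B x p : disj A B -> x \in Psub P (A `|` B) ->
  p \in PDelta P A B x -> p.1 \in Psub P A /\ p.2 \in Psub P B.
Proof. by move=> AB xAB /(allP (Delta_sub HP AB xAB)) /andP. Qed.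

Lemma Pdelta_mem A x p : x \in Psub P A -> p \in Pdelta P A x ->
  p.1 \in Psub P A /\ p.2 \in Psub P A.
Proof. by move=> xA /(allP (delta_sub HP xA)) /andP. Qed.

Lemma conv_lin A B (f1 f2 : PV P -> K) : disj A B -> lin_on (Psub P A) f1 -> lin_on (Psub P B) f2 ->
  lin_on (Psub P (A `|` B)) (conv A B f1 f2).
Proof.
move=> AB l1 l2 a x y xAB yAB; rewrite /conv.
rewrite (teq2_lin_on _ _ l1 l2 _ _ (Delta_lin HP a AB xAB yAB)) //.
- rewrite big_cat (sum_tscale _ _ _ l1) // => p px.
  by have [] := PDelta_mem AB xAB px.
- by apply: (Delta_sub HP) => //; apply: (sub_lin HP).
- rewrite all_cat (Delta_sub HP) // andbT /tscale all_map.
  apply/allP => p /(PDelta_mem AB xAB)[p1 p2] /=.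
  by rewrite p2 andbT -[_ *: _]addr0; apply: (sub_lin HP) => //; apply: (sub_0 HP).
Qed.

Lemma eq_conv A B (f1 f2 g1 g2 : PV P -> K) x : disj A B -> x \in Psub P (A `|` B) ->
  {in Psub P A, f1 =1 g1} -> {in Psub P B, f2 =1 g2} ->
  conv A B f1 f2 x = conv A B g1 g2 x.
Proof.
move=> AB xAB e1 e2; apply: eq_big_seq => p /(PDelta_mem AB xAB)[p1 p2].
by rewrite e1 ?e2.
Qed.

(** Coassociativity paired with [f1 (x) f2 (x) f3]. *)
Lemma convA A B C (f1 f2 f3 : PV P -> K) x : disj A B -> disj A C -> disj B C ->
  lin_on (Psub P A) f1 -> lin_on (Psub P B) f2 -> lin_on (Psub P C) f3 ->
  x \in Psub P (A `|` B `|` C) ->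
  conv (A `|` B) C (conv A B f1 f2) f3 x = conv A (B `|` C) f1 (conv B C f2 f3) x.
Proof.
move=> AB AC BC l1 l2 l3 xABC.
have xABC' : x \in Psub P (A `|` (B `|` C)) by rewrite fsetUA.
have dl : disj (A `|` B) C by rewrite disjUl AC.
have dr : disj A (B `|` C) by rewrite disjUr AB.
have := teq3_lin_on _ _ _ l1 l2 l3 _ _ (Delta_coass HP AB AC BC xABC).
rewrite !big_flatten !big_map /conv => E.
transitivity (\sum_(p <- PDelta P (A `|` B) C x)
   \sum_(q <- PDelta P A B p.1) f1 q.1 * f2 q.2 * f3 p.2).
  by apply: eq_bigr => p _; rewrite mulr_suml.
transitivity (\sum_(p <- PDelta P A (B `|` C) x)
   \sum_(q <- PDelta P B C p.2) f1 p.1 * f2 q.1 * f3 q.2); last first.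
  by apply: eq_bigr => p _; rewrite mulr_sumr; apply: eq_bigr => q _; rewrite mulrA.
(* The nested sums are put in the shape of sums over flattened lists of triples, to match [E]. *)
under eq_bigr do rewrite -(big_map (fun q => (q.1, q.2, _)) xpredT
  (fun p => f1 p.1.1 * f2 p.1.2 * f3 p.2)).
under [RHS]eq_bigr => p _ do
  rewrite -(big_map (fun q => (p.1, q.1, q.2)) xpredT (fun p => f1 p.1.1 * f2 p.1.2 * f3 p.2)).
apply: E => // p /flattenP[_ /mapP[q qx ->] /mapP[r rq ->]] /=.
- have [q1 q2] := PDelta_mem dl xABC qx.
  by have [] := PDelta_mem AB q1 rq.
- have [q1 q2] := PDelta_mem dr xABC' qx.
  by have [] := PDelta_mem BC q2 rq.
Qed.

Lemma conv_epsl A (f2 : PV P -> K) x : lin_on (Psub P A) f2 -> x \in Psub P A ->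
  conv fset0 A (Peps P) f2 x = f2 x.
Proof.
move=> l2 xA; rewrite -[in RHS](Delta_counitl HP xA) (lin_on_sum _ _ l2) // => p px.
by have [] := PDelta_mem (disj0l A) _ px; rewrite ?fset0U.
Qed.

Lemma conv_epsr A (f1 : PV P -> K) x : lin_on (Psub P A) f1 -> x \in Psub P A ->
  conv A fset0 f1 (Peps P) x = f1 x.
Proof.
move=> l1 xA; rewrite -[in RHS](Delta_counitr HP xA) (lin_on_sum _ _ l1) //.
  by apply: eq_bigr => p _; rewrite mulrC.
by move=> p px; have [] := PDelta_mem (disj0r A) _ px; rewrite ?fsetU0.
Qed.

Lemma iconv_lin f w : lin_fam f -> pairwise disj w ->
  lin_on (Psub P (bigU w)) (iconv f w).
Proof.
move=> fl; elim: w => [_|X w IH /= /andP[Xw /IH{}IH]]; first exact: (eps_lin HP).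
by apply: conv_lin => //; rewrite disj_bigU.
Qed.

(** Induction on [u]: the counit gives the base case and [convA] the step. *)
Lemma iconv_cat f u v x : lin_fam f -> pairwise disj (u ++ v) ->
  x \in Psub P (bigU (u ++ v)) ->
  iconv f (u ++ v) x = conv (bigU u) (bigU v) (iconv f u) (iconv f v) x.
Proof.
move=> fl; elim: u x => [|X u IH] x /=.
  by move=> vd xv; rewrite conv_epsl //; apply: iconv_lin.
rewrite bigU_cat => /andP[Xuv uvd] xuv.
have [uv ud vd] : [/\ disj (bigU u) (bigU v), pairwise disj u & pairwise disj v].
  move: uvd; rewrite pairwise_cat => /and3P[uv ud vd]; split => //.
  elim: (u) uv => [|Y u' IHu]; first by rewrite disj0l.
  by rewrite allrel_consl /= disjUl (disj_bigU Y) => /andP[-> /IHu].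
move: Xuv; rewrite -disj_bigU bigU_cat disjUr => /andP[Xu Xv].
rewrite convA ?iconv_lin -?fsetUA //; last exact: (iconv_lin fl); last exact: (iconv_lin fl).
apply: eq_conv => //; first by rewrite disjUr Xu.
by move=> y yuv; rewrite IH // bigU_cat.
Qed.

(** A character without naturality; on the empty set, [f (Pone P) = 1] becomes agreement
    with epsilon, which is equivalent only for connected [P]. *)
Record pre_char f : Prop := PreChar {
  pre_char_lin : lin_fam f;
  pre_char_mul : forall A B x y, disj A B -> x \in Psub P A -> y \in Psub P B ->
    f (A `|` B) (Pmul P A B x y) = f A x * f B y;
  pre_char_eps : {in Psub P fset0, f fset0 =1 Peps P}
}.

(** At an empty block [f] is [Peps P], which the counit axiom absorbs. *)
Lemma iconv_drop_empty f w x : pre_char f -> pairwise disj w -> x \in Psub P (bigU w) ->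
  iconv f (drop_empty w) x = iconv f w x.
Proof.
move=> [fl _ f0]; elim: w x => //= X w IH x /andP[Xw wd] xw.
have [X0|X0] := eqVneq X fset0; last first.
  rewrite /= bigU_drop_empty; apply: eq_conv => //; first by rewrite disj_bigU.
  by move=> y yw; apply: IH.
subst X; move: xw; rewrite fset0U => xw; rewrite IH //.
rewrite -[LHS](conv_epsl _ xw); last exact: iconv_lin.
by apply: eq_conv; rewrite ?disj0l ?fset0U // => y /f0.
Qed.

Lemma iconv1 f A x : pre_char f -> x \in Psub P A -> iconv f [:: A] x = f A x.
Proof. by move=> [fl _ _] xA; apply: conv_epsr (fl A) xA. Qed.

(** Induction on [w]: [Delta_mul] splits the coproduct of the product, and [f] is multiplicative on
    the first block, decomposed as [A]&[X] and [B]&[X]. Empty intersections are kept here so that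
    both words follow [w] block by block. *)
Lemma iconv_mul_setI f w A B x y : pre_char f -> pairwise disj w -> disj A B ->
  A `|` B = bigU w -> x \in Psub P A -> y \in Psub P B ->
  iconv f w (Pmul P A B x y) =
  iconv f [seq A `&` X | X <- w] x * iconv f [seq B `&` X | X <- w] y.
Proof.
move=> fP; have [fl fm f0] := fP; elim: w A B x y => [|X w IH] A B x y.
  move=> _ _ /eqP; rewrite /= fsetU_eq0 => /andP[/eqP -> /eqP ->].
  exact: (eps_mul HP).
rewrite /= -disj_bigU => /andP[Xw wd] AB ABw xA yB.
set W := bigU w in Xw ABw *.
have Aw : A = (A `&` X) `|` (A `&` W) by rewrite -fsetIUr -ABw fsetKU.
have Bw : B = (B `&` X) `|` (B `&` W) by rewrite -fsetIUr -ABw fsetUC fsetKU.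
have ABX : (A `&` X) `|` (B `&` X) = X.
  by rewrite -fsetIUl ABw fsetUC fsetIC; apply/fsetIidPl; apply: fsubsetUr.
have ABW : (A `&` W) `|` (B `&` W) = W.
  by rewrite -fsetIUl ABw fsetIC; apply/fsetIidPl; apply: fsubsetUr.
have dABX : disj (A `&` X) (B `&` X) by apply: disjS AB; apply: fsubsetIl.
have dABW : disj (A `&` W) (B `&` W) by apply: disjS AB; apply: fsubsetIl.
have dA : disj (A `&` X) (A `&` W) by apply: disjS Xw; apply: fsubsetIr.
have dB : disj (B `&` X) (B `&` W) by apply: disjS Xw; apply: fsubsetIr.
have xA' : x \in Psub P ((A `&` X) `|` (A `&` W)) by rewrite -Aw.
have yB' : y \in Psub P ((B `&` X) `|` (B `&` W)) by rewrite -Bw.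
(* The induction hypothesis intersects with [A]&[W] and [B]&[W]; blocks of [w] already lie in
   [W]. *)
have setIw C : [seq C `&` W `&` Y | Y <- w] = [seq C `&` Y | Y <- w].
  apply/eq_in_map => Y Yw; rewrite -fsetIA; congr (_ `&` _); apply/fsetIidPr.
  by apply/fsubsetP => z zY; rewrite in_bigU; apply/hasP; exists Y.
rewrite /conv !bigU_setI -/W.
rewrite (teq2_lin_on _ _ (fl X) (iconv_lin fl wd) _ _ (Delta_mul HP AB Xw ABw xA yB)) //.
- rewrite big_flatten big_map mulr_suml; apply: eq_big_seq => p /(PDelta_mem dA xA')[p1 p2].
  rewrite big_map mulr_sumr; apply: eq_big_seq => q /(PDelta_mem dB yB')[q1 q2] /=.
  rewrite (IH _ _ _ _ wd dABW ABW) // !setIw.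
  have := fm _ _ _ _ dABX p1 q1; rewrite ABX => ->.
  by rewrite mulrACA.
- apply: (Delta_sub HP) => //; rewrite -ABw; exact: (mul_sub HP).
- apply/allP => r /flattenP[_ /mapP[p /(PDelta_mem dA xA')[p1 p2] ->]].
  case/mapP => q /(PDelta_mem dB yB')[q1 q2] -> /=; apply/andP; split.
    by have := mul_sub HP dABX p1 q1; rewrite ABX.
  by have := mul_sub HP dABW p2 q2; rewrite ABW.
Qed.

Lemma iconv_mul f w A B x y : pre_char f -> pairwise disj w -> disj A B ->
  A `|` B = bigU w -> x \in Psub P A -> y \in Psub P B ->
  iconv f w (Pmul P A B x y) = iconv f (restr A w) x * iconv f (restr B w) y.
Proof.
move=> fP wd AB ABw xA yB; rewrite iconv_mul_setI // /restr !iconv_drop_empty //.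
- by apply: pairwise_disj_setI.
- by rewrite bigU_setI -ABw fsetUC fsetKU.
- by apply: pairwise_disj_setI.
- by rewrite bigU_setI -ABw fsetKU.
Qed.

Lemma iconv_act f s w x : lin_fam f ->
  (forall A y, injon s A -> y \in Psub P A -> f (img s A) (Pact P s A y) = f A y) ->
  injon s (bigU w) -> pairwise disj w -> x \in Psub P (bigU w) ->
  iconv f [seq img s X | X <- w] (Pact P s (bigU w) x) = iconv f w x.
Proof.
move=> fl fn; elim: w x => [|X w IH] x sw.
  (* On the empty set [s] agrees with the identity. *)
  move=> _ xw /=; have s0 : injon id fset0 by move=> i j; rewrite inE.
  by rewrite (@act_ext _ _ HP s id) ?(act_id HP) // => i; rewrite inE.
rewrite /= -disj_bigU => /andP[Xw wd] xw.
have sw' : injon s (bigU w) by apply: injonS sw; apply: fsubsetUr.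
have sX : injon s X by apply: injonS sw; apply: fsubsetUl.
have iw := pairwise_disj_img sw' wd; have Xiw := disj_img sw Xw.
have il := iconv_lin fl iw; rewrite bigU_img in il *.
rewrite /conv (teq2_lin_on _ _ (fl _) il _ _ (Delta_nat HP sw Xw xw)) //.
- rewrite big_map; apply: eq_big_seq => p /(PDelta_mem Xw xw)[p1 p2] /=.
  by rewrite fn // IH.
- apply: (Delta_sub HP) => //; have := act_sub HP sw xw.
  by rewrite -[X `|` bigU w]/(bigU (X :: w)) -bigU_img /= bigU_img.
- apply/allP => _ /mapP[p /(PDelta_mem Xw xw)[p1 p2] ->] /=.
  by rewrite !(act_sub HP).
Qed.

(** [Delta_delta] moves the coproduct past [delta], and multiplicativity of [f] separates the first
    block from the rest. The left counit of [delta] turns the first factor into [f X]; induction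
    handles the second. The empty word is the compatibility [eps_delta]. *)
Lemma iconv_delta f u x : pre_char f -> pairwise disj u -> x \in Psub P (bigU u) ->
  \sum_(p <- Pdelta P (bigU u) x) iconv (Peps' P) u p.1 * f (bigU u) p.2 = iconv f u x.
Proof.
move=> [fl fm f0].
have el : lin_fam (Peps' P) by move=> A a y z; apply: (eps'_lin HP).
elim: u x => [|X u IH] x.
  move=> _ /= x0.
  rewrite -(lin_on_sum _ _ (fl fset0)) ?(eps_delta HP) //; last first.
    by move=> p px; have [] := Pdelta_mem x0 px.
  rewrite (lin_onZ _ _ (fl fset0)) ?f0 ?(one_sub HP) //.
  by rewrite (eps_one HP) mulr1.
rewrite /= -disj_bigU => /andP[Xu ud] xXu; set U := bigU u in Xu xXu *.
have := teq3_lin_on _ _ _ (el X) (iconv_lin el ud) (fl (X `|` U)) _ _ (Delta_delta HP Xu xXu).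
rewrite !big_flatten !big_map => E.
transitivity (\sum_(p <- Pdelta P (X `|` U) x)
   \sum_(q <- PDelta P X U p.1) Peps' P X q.1 * iconv (Peps' P) u q.2 * f (X `|` U) p.2).
  by apply: eq_bigr => p _; rewrite mulr_suml.
under eq_bigr do rewrite -(big_map (fun q => (q.1, q.2, _)) xpredT
  (fun p => Peps' P X p.1.1 * iconv (Peps' P) u p.1.2 * f (X `|` U) p.2)).
rewrite {}E //.
- apply: eq_big_seq => p /(PDelta_mem Xu xXu)[p1 p2].
  rewrite big_allpairs_dep -[in RHS](delta_counitl HP p1) -(IH _ ud p2).
  rewrite (lin_on_sum _ _ (fl X)) //; last by move=> q /(Pdelta_mem p1)[].
  rewrite mulr_suml; apply: eq_big_seq => a /(Pdelta_mem p1)[a1 a2].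
  rewrite mulr_sumr; apply: eq_big_seq => b /(Pdelta_mem p2)[b1 b2] /=.
  by rewrite fm // -!mulrA; congr (_ * _); rewrite mulrCA.
- move=> p /flattenP[_ /mapP[q /(Pdelta_mem xXu)[q1 q2] ->] /mapP[r /(PDelta_mem Xu q1)[r1 r2] ->]].
  by [].
- move=> p /flattenP[_ /mapP[q /(PDelta_mem Xu xXu)[q1 q2] ->]].
  case/allpairsP => -[a b] /= [/(Pdelta_mem q1)[a1 a2] /(Pdelta_mem q2)[b1 b2] ->] /=.
  by split => //; apply: (mul_sub HP).
Qed.

End IteratedCoproducts.

(** * Morphisms to Comp *)

Lemma is_comp_pairwise A w : is_comp A w -> pairwise disj w.
Proof. by case/andP => /andP[]. Qed.

(** * Set compositions block by block, and their finite enumeration *)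

Lemma is_comp_cons A (X : lset) w :
  is_comp A (X :: w) = [&& X != fset0, X `<=` A & is_comp (A `\` X) w].
Proof.
rewrite -[X :: w]/([:: X] ++ w) is_comp_cat /is_comp /= !fsetU0 !eqxx !andbT.
case: (X != fset0) => //=; case: (all _ w) => /=; last by rewrite andbF.
case: (pairwise _ w) => /=; last by rewrite andbF.
apply/andP/andP => [[d /eqP <-]|[/fsetUidPr XA /eqP ->]].
  split; first exact: fsubsetUl.
  rewrite fsetDUl fsetDv fset0U; apply/eqP/esym/fsetDidPl; rewrite fdisjoint_sym; exact: d.
split; first by apply/disjP => x xX; rewrite inE xX.
by rewrite fsetUDl fsetDv fsetD0 XA.
Qed.

Lemma size_is_comp A w : is_comp A w -> (size w <= #|` A|)%N.
Proof.
elim: w A => //= X w IH A; rewrite is_comp_cons => /and3P[X0 XA /IH].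
move=> h; apply: leq_ltn_trans h _.
rewrite cardfsD (fsetIidPr XA) ltn_subrL cardfs_gt0 X0.
by rewrite (leq_trans _ (fsubset_leq_card XA)) // cardfs_gt0.
Qed.

(** The fuel [n] bounds the number of blocks; the cardinal of [A] suffices because blocks are
    nonempty. *)
Fixpoint comps_upto n (A : lset) : seq word :=
  (if A == fset0 then [:: [::]] else [::]) ++
  (if n is n'.+1 then
     [seq X :: w | X <- enum_fset (fpowerset A `\ fset0), w <- comps_upto n' (A `\` X)]
   else [::]).

Lemma mem_comps_upto n A w : (w \in comps_upto n A) = is_comp A w && (size w <= n)%N.
Proof.
elim: n A w => [|n IH] A w /=; rewrite mem_cat.
  rewrite orbF; case: w => [|X w]; last by rewrite andbF; case: ifP.
  by rewrite /is_comp /= andbT eq_sym; case: eqP.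
case: w => [|X w].
  rewrite andbT [X in X || _](_ : _ = is_comp A [::]); last first.
    by rewrite /is_comp /= eq_sym; case: eqP.
  by rewrite [X in _ || X](_ : _ = false) ?orbF //; apply/negP => /allpairsPdep[? [? []]].
rewrite [X in X || _](_ : _ = false) /=; last by case: ifP.
rewrite is_comp_cons ltnS; apply/allpairsPdep/andP.
  case=> Y [v [+ + [-> ->]]]; rewrite !inE IH fpowersetE => /andP[-> ->] /andP[-> ->].
  by [].
case=> /and3P[X0 XA wc] wn; exists X, w; split => //; last by rewrite IH wc.
by rewrite !inE X0 fpowersetE.
Qed.

(** Duplicates are removed so that a sum over this list meets each composition once. *)
Definition comps (A : lset) : seq word := undup (comps_upto #|` A| A).

Lemma mem_comps A w : (w \in comps A) = is_comp A w.
Proof.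
rewrite mem_undup mem_comps_upto; case wA: is_comp => //=.
exact: size_is_comp.
Qed.

Lemma is_comp0 w : is_comp fset0 w = (w == [::]).
Proof.
case: w => [|X w]; first by rewrite /is_comp /= eqxx.
by rewrite is_comp_cons fsubset0; case: eqP.
Qed.

Lemma is_comp_drop_empty1 A : is_comp A (drop_empty [:: A]).
Proof. by have := @is_comp_of_drop_empty [:: A] isT; rewrite /= fsetU0. Qed.

(** [B] is separate from [A] because the induction removes blocks of [c] from [B] while [d] stays
    fixed. *)
Lemma is_comp_flatten_restr A B c d : B `<=` A -> is_comp A d -> is_comp B c ->
  is_comp B (flatten [seq restr X d | X <- c]).
Proof.
move=> + dA; elim: c B => //= X w IH B BA.
rewrite is_comp_cons => /and3P[X0 XB wc].
have {}IH := IH _ (fsubset_trans (fsubsetDl _ _) BA) wc.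
have := is_comp_restr X (is_comp_pairwise dA).
rewrite (is_comp_bigU dA) (fsetIidPl (fsubset_trans XB BA)) => Xc.
rewrite is_comp_cat (is_comp_bigU Xc) (is_comp_bigU IH) Xc IH /=; apply/andP; split.
  by apply/disjP => x xX; rewrite inE xX.
by rewrite fsetUDl fsetDv fsetD0; apply/eqP/fsetUidPr.
Qed.

Lemma is_comp_preim s A c : injon s A -> is_comp (img s A) c ->
  is_comp A [seq [fset x in A | s x \in X] | X <- c].
Proof.
move=> sA; elim: c A sA => [|X c IH] A sA.
  rewrite /is_comp /= eq_sym => /eqP i0; rewrite eq_sym; apply/negPn/negP => /fset0Pn[x xA].
  by have : s x \in img s A; [apply: in_imfset|rewrite i0].
rewrite is_comp_cons => /and3P[/fset0Pn[y yX] /fsubsetP XA wc].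
set B := [fset x in A | s x \in X].
have BA : B `<=` A by apply/fsubsetP => x; rewrite !inE => /andP[].
have AB : img s (A `\` B) = img s A `\` X.
  apply/fsetP => z; rewrite inE; apply/imfsetP/andP => [[x /=]|[zX /imfsetP[x /= xA E]]].
    by rewrite !inE /= => /andP[] + xA ->; rewrite xA /= => ->; split => //; apply: in_imfset.
  by exists x; rewrite // !inE /= xA -E zX.
have YX Y z : Y \in c -> z \in Y -> z \notin X.
  move=> Yc zY; have : z \in bigU c by rewrite in_bigU; apply/hasP; exists Y.
  by rewrite (is_comp_bigU wc) inE => /andP[].
rewrite -AB in wc; have {}wc := IH _ (injonS (fsubsetDl _ _) sA) wc.
rewrite /= is_comp_cons BA; apply/and3P; split => //.
  have /imfsetP[x /= xA E] := XA _ yX; apply/fset0Pn; exists x.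
  by rewrite !inE /= xA -E.
suff <- : [seq [fset x in A `\` B | s x \in Y] | Y <- c] = [seq [fset x in A | s x \in Y] | Y <- c].
  exact: wc.
have {}YX : {in c, forall Y z, z \in Y -> z \notin X} by move=> Y Yc z; apply: YX.
elim: c YX {IH wc} => //= Y c IH YX; congr (_ :: _); last first.
  by apply: IH => Z Zc; apply: YX; rewrite inE Zc orbT.
apply/fsetP => x; rewrite !inE /=; case xA: (x \in A); rewrite ?andbF // andbT /=.
by apply: andb_idl => /YX; apply; rewrite inE eqxx.
Qed.

Lemma is_comp_cat_disj A B c d : disj A B ->
  is_comp A c && is_comp B d = (bigU c == A) && is_comp (A `|` B) (c ++ d).
Proof.
move=> AB; rewrite is_comp_cat; apply/andP/and5P => [[cA dB]|[/eqP cU cc dd ddisj /eqP U]].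
  by rewrite (is_comp_bigU cA) (is_comp_bigU dB) cA dB.
rewrite -{1}cU cc -[X in is_comp X d](_ : bigU d = B) ?dd //.
rewrite cU in ddisj U.
have e C : disj A C -> C = (A `|` C) `\` A.
  move=> /disjP AC; apply/fsetP => x; rewrite !inE; case xA: (x \in A) => //=.
  by apply/negP => /(AC x xA).
by rewrite [LHS](e _ ddisj) U -e.
Qed.

(** * Correspondence between characters and bialgebra morphisms *)

Section UniversalProperty.
Variables (K : fieldType) (P : dtb_data K).
Hypothesis HP : is_dtb P.
Implicit Types (f g : charf P) (phi psi : morph P).

(** A normal form for both directions: a representing [phi] exists for every [f], and its
    coefficients are determined by [f]. Uniqueness and both inversion formulas then compare
    functionals only. *)
Definition represents phi f : Prop :=
  (forall A x, x \in Psub P A -> supp_comp A (phi A x)) /\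
  (forall A x c, x \in Psub P A -> coef (phi A x) c = (is_comp A c)%:R * iconv f c x).

Lemma eq_iconv f g w x : same_char f g -> pairwise disj w -> x \in Psub P (bigU w) ->
  iconv f w x = iconv g w x.
Proof.
move=> fg; elim: w x => //= X w IH x; rewrite -disj_bigU => /andP[Xw wd] xw.
by apply: (eq_conv HP) => // y yw; [apply: fg|apply: IH].
Qed.

Lemma represents_same phi psi f g : represents phi f -> represents psi g ->
  same_char f g -> same_morph phi psi.
Proof.
move=> [_ pf] [_ pg] fg A x xA c; rewrite pf // pg //.
case cA: (is_comp A c); rewrite ?mul0r // !mul1r.
by apply: eq_iconv => //; rewrite ?(is_comp_bigU cA) ?(is_comp_pairwise cA).
Qed.

Lemma represents_exists f : exists phi, represents phi f.
Proof.
exists (fun A x => [seq (iconv f w x, w) | w <- comps A]); split.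
  by move=> A x _; apply/allP => _ /mapP[w + ->]; rewrite mem_comps.
move=> A x c _; rewrite coefE big_map -mem_comps /=.
case cA: (c \in comps A); last first.
  rewrite mul0r big1_seq // => w /andP[_ wA]; case: eqP => [E|]; rewrite ?mulr0 //.
  by rewrite -E wA in cA.
rewrite (bigD1_seq c) ?undup_uniq //= eqxx mulrC big1 ?addr0 // => w /negPf ->.
by rewrite mulr0.
Qed.

Lemma coef2_phi2 phi A B s c d :
  coef2 (phi2 phi A B s) (c, d) = \sum_(p <- s) coef (phi A p.1) c * coef (phi B p.2) d.
Proof.
rewrite coef2E big_flatten big_map; apply: eq_bigr => p _.
rewrite big_allpairs_dep coefE mulr_suml; apply: eq_bigr => a _.
rewrite coefE mulr_sumr; apply: eq_bigr => b _ /=.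
by rewrite -pair_eqE /= -mulnb natrM mulrACA.
Qed.

(** The unit is nonzero, as its counit is 1, so it spans the line [Psub P fset0]. Connectedness
    enters the proof through this fact. *)
Lemma unit_exists x : connected P -> x \in Psub P fset0 -> exists a, x = a *: Pone P.
Proof.
move=> [e [e0 _ eP]] /eP[a ->]; have [b bE] := eP _ (one_sub HP).
have b0 : b != 0.
  apply: contra_eq_neq (eps_one HP); move: bE => -> ->; rewrite scale0r.
  rewrite (lin_on0 (Psub_subspace HP fset0)) 1?eq_sym ?oner_neq0 //; exact: (eps_lin HP).
by exists (a / b); rewrite bE scalerA mulfVK.
Qed.

Hypothesis Pconn : connected P.

(** On the line spanned by the unit, [f] and [Peps P] are linear and both take the value 1 at the
    unit. *)
Lemma char_pre_char f : is_char f -> pre_char f.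
Proof.
move=> [fl _ fm f1]; split => // x x0; have [a ->] := unit_exists Pconn x0.
have S := Psub_subspace HP fset0.
rewrite (lin_onZ _ S (fl fset0)) ?(one_sub HP) // f1.
by rewrite (lin_onZ _ S (eps_lin HP)) ?(one_sub HP) // (eps_one HP).
Qed.

Lemma eps'_char : is_char (Peps' P).
Proof.
split; [exact: (eps'_lin HP)|exact: (eps'_nat HP)|exact: (eps'_mul HP)|exact: (eps'_one HP)].
Qed.

Lemma represents_eps' phi f : is_char f -> represents phi f -> same_char (eps'_comp phi) f.
Proof.
move=> fc [ps pf] A x xA; have fp := char_pre_char fc.
rewrite /eps'_comp (coef_comp_eps' (ps _ _ xA)) pf // is_comp_drop_empty1 mul1r.
by rewrite (iconv_drop_empty HP fp) ?(iconv1 HP fp) //= fsetU0.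
Qed.

Lemma represents_bimorph phi f : is_char f -> represents phi f -> is_bimorph phi.
Proof.
move=> fc [ps pf]; have fp := char_pre_char fc; have [fl fn fm f1] := fc.
split=> //.
- move=> A a x y xA yA c; rewrite !pf //; last exact: (sub_lin HP).
  case cA: (is_comp A c); rewrite ?mul0r ?mulr0 ?addr0 // !mul1r.
  apply: (iconv_lin HP) => //; rewrite ?(is_comp_bigU cA) //.
  exact: is_comp_pairwise cA.
- move=> s A x sA xA c; rewrite pf ?(act_sub HP) // (coef_fs_act _ sA (ps _ _ xA)) pf //.
  case cA: (is_comp (img s A) c); rewrite ?mul0r // !mul1r.
  set w := [seq _ | _ <- c]; have wA : is_comp A w by apply: is_comp_preim.
  (* [c] is the image of [w], so [iconv_act] applies. *)
  have := img_word_eq c sA wA; rewrite cA eqxx /= => /eqP <-; clearbody w.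
  have wU := is_comp_bigU wA; rewrite wA mul1r; subst A.
  exact: (iconv_act HP fl (fn s) sA (is_comp_pairwise wA) xA).
- move=> A B x y AB xA yB c.
  rewrite pf ?(mul_sub HP) // (coef_fs_mul _ AB (ps _ _ xA) (ps _ _ yB)) !pf //.
  case cA: (is_comp _ c); rewrite ?mul0r // !mul1r.
  have cd := is_comp_pairwise cA; have cU := is_comp_bigU cA.
  have := is_comp_restr A cd; rewrite cU fsetKU => ->.
  have := is_comp_restr B cd; rewrite cU fsetUC fsetKU => ->.
  by rewrite !mul1r (iconv_mul HP fp).
- move=> c; rewrite pf ?(one_sub HP) // is_comp0 coefE big_seq1 mul1r [_ == c]eq_sym /=.
  by case: (c =P [::]) => [->|_]; rewrite ?mul0r // mul1r /= (eps_one HP).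
- move=> A B x AB xAB [c d].
  rewrite coef2_phi2 (coef_comp_Delta _ _ AB (ps _ _ xAB)) pf // mulrA.
  rewrite -natrM mulnb -is_comp_cat_disj //.
  transitivity (\sum_(p <- PDelta P A B x)
    (is_comp A c && is_comp B d)%:R * (iconv f c p.1 * iconv f d p.2)).
    apply: eq_big_seq => p /(PDelta_mem HP AB xAB)[p1 p2].
    by rewrite !pf // -mulnb natrM mulrACA.
  rewrite -mulr_sumr; case cA: (is_comp A c); case dB: (is_comp B d); rewrite ?mul0r // !mul1r.
  have := is_comp_cat_disj c d AB; rewrite cA dB => /esym/andP[_ cdA].
  rewrite (iconv_cat HP) ?(is_comp_pairwise cdA) ?(is_comp_bigU cdA) //.
  by rewrite (is_comp_bigU cA) (is_comp_bigU dB).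
- by move=> x x0; rewrite pf // is_comp0 mul1r.
Qed.

(** Induction on the word: the coefficient of [X :: w] is that of [([:: X], w)] after
    deconcatenation, which [bm_Delta] computes as a convolution. The empty word is the counit
    condition [bm_eps]. *)
Lemma bimorph_represents phi : is_bimorph phi -> represents phi (eps'_comp phi).
Proof.
move=> pb; have ps A x : x \in Psub P A -> supp_comp A (phi A x) by apply: (bm_support pb).
split=> // A x c; elim: c A x => [|X w IH] A x xA.
  case: (eqVneq A fset0) xA => [->|A0] xA.
    by rewrite is_comp0 eqxx mul1r (bm_eps pb).
  by rewrite /is_comp /= eq_sym (negPf A0) mul0r (coef_supp (ps _ _ xA)) // /is_comp /= eq_sym.
case cA: (is_comp A (X :: w)); last by rewrite mul0r (coef_supp (ps _ _ xA)) ?cA.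
have := cA; rewrite -[X :: w]/([:: X] ++ w) is_comp_cat /= fsetU0 => /and4P[X1 wc Xw /eqP E].
subst A; have := bm_Delta pb Xw xA ([:: X], w).
rewrite coef2_phi2 (coef_comp_Delta _ _ Xw (ps _ _ xA)) /= fsetU0 eqxx !mul1r => <-.
apply: eq_big_seq => p /(PDelta_mem HP Xw xA)[p1 p2].
by rewrite IH // wc mul1r /eps'_comp (coef_comp_eps' (ps _ _ p1)) (is_comp_drop_empty X1).
Qed.

(** [eps'] reads the coefficient at a one-block composition, and the restrictions of such a
    composition are again of this kind. *)
Lemma bimorph_char phi : is_bimorph phi -> is_char (eps'_comp phi).
Proof.
move=> pb; have ps A x : x \in Psub P A -> supp_comp A (phi A x) by apply: (bm_support pb).
have eE A x : x \in Psub P A -> eps'_comp phi A x = coef (phi A x) (drop_empty [:: A]).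
  by move=> xA; rewrite /eps'_comp (coef_comp_eps' (ps _ _ xA)).
split.
- move=> A a x y xA yA; rewrite !eE //; last exact: (sub_lin HP).
  exact: (bm_lin pb).
- move=> s A x sA xA; rewrite !eE ?(act_sub HP) // (bm_nat pb) //.
  rewrite (coef_fs_act _ sA (ps _ _ xA)) is_comp_drop_empty1 mul1r; congr coef.
  have [/eqP ->|A0] := boolP (A == fset0); first by rewrite /img imfset0 /drop_empty /=.
  rewrite /drop_empty /= A0 (_ : img s A != fset0) /=; last first.
    by have /fset0Pn[y yA] := A0; apply/fset0Pn; exists (s y); apply: in_imfset.
  by congr [:: _]; apply/fsetP => y; rewrite !inE /=; case yA: (y \in A) => //=; apply: in_imfset.
- move=> A B x y AB xA yB; rewrite !eE ?(mul_sub HP) // (bm_mul pb) //.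
  rewrite (coef_fs_mul _ AB (ps _ _ xA) (ps _ _ yB)) is_comp_drop_empty1 mul1r !restr_drop_empty.
  by rewrite /restr /= fsetKU fsetUC fsetKU.
- by rewrite eE ?(one_sub HP) // (bm_one pb) coefE big_seq1 /drop_empty /= mul1r.
Qed.

Lemma represents_arrow phi f : is_char f -> represents phi (Peps' P) ->
  represents (arrow phi f) f.
Proof.
move=> fc [ps pf]; split=> A x => [xA|c xA].
  apply/allP => _ /flattenP[_ /mapP[q /(Pdelta_mem HP xA)[q1 q2] ->] /mapP[p + ->]].
  exact: (allP (ps _ _ q1)).
rewrite coefE big_flatten big_map.
transitivity (\sum_(q <- Pdelta P A x) (is_comp A c)%:R * (iconv (Peps' P) c q.1 * f A q.2)).
  apply: eq_big_seq => q /(Pdelta_mem HP xA)[q1 q2]; rewrite big_map mulrA -pf // coefE mulr_suml.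
  by apply: eq_bigr => p _ /=; rewrite -mulrA mulrC.
rewrite -mulr_sumr; case cA: (is_comp A c); rewrite ?mul0r // !mul1r.
have cU := is_comp_bigU cA.
by rewrite -{1 2}cU (iconv_delta HP (char_pre_char fc)) ?cU // (is_comp_pairwise cA).
Qed.

(** The value [0] when [A] is not covered by [d] keeps the family multiplicative. *)
Definition restr_fam f (d : word) : charf P :=
  fun A x => if A `<=` bigU d then iconv f (restr A d) x else 0.

(** Multiplicativity is [iconv_mul] along the restriction of [d] to the union, whose further
    restrictions are those of [d] itself. *)
Lemma restr_fam_pre_char f d : pre_char f -> pairwise disj d -> pre_char (restr_fam f d).
Proof.
move=> fp dd; have [fl fm f0] := fp; rewrite /restr_fam; split.
- move=> A a x y xA yA; case: ifP => [/fsetIidPl Ad|_]; last by rewrite mulr0 addr0.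
  have rA := is_comp_restr A dd; rewrite Ad in rA.
  by apply: (iconv_lin HP) => //; rewrite ?(is_comp_bigU rA) ?(is_comp_pairwise rA).
- move=> A B x y AB xA yB; rewrite fsubUset.
  (* If [d] fails to cover [A] or [B], it fails to cover the union, and both sides are 0. *)
  case: ifP => [/andP[Ad Bd]|]; last by case: ifP => //= _; case: ifP; rewrite ?mulr0 ?mul0r.
  have ABd : A `|` B `<=` bigU d by rewrite fsubUset Ad.
  rewrite Ad Bd.
  have rA := is_comp_restr (A `|` B) dd; rewrite (fsetIidPl ABd) in rA.
  rewrite (iconv_mul HP fp (is_comp_pairwise rA) AB) ?(is_comp_bigU rA) //.
  by rewrite !restr_restr fsetKU [B `&` _](_ : _ = B) // fsetUC fsetKU.
- by move=> x x0; rewrite fsub0set restr_disj ?disj0l.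
Qed.

(** By [iconv_cat], evaluating the restricted family along [c] concatenates the words [restr X d].
    The result is the word found in [coef_comp_delta]. *)
Lemma iconv_restr_fam f A B c d x : pre_char f -> B `<=` A -> is_comp A d -> is_comp B c ->
  x \in Psub P B ->
  iconv (restr_fam f d) c x = iconv f (flatten [seq restr X d | X <- c]) x.
Proof.
move=> fp BA dA; have fl := pre_char_lin fp.
elim: c B BA x => //= X c IH B BA x cB xB.
have := is_comp_flatten_restr BA dA cB; move: (cB).
rewrite is_comp_cons /= => /and3P[X0 XB cX] fB.
have := is_comp_restr X (is_comp_pairwise dA).
rewrite (is_comp_bigU dA) (fsetIidPl (fsubset_trans XB BA)) => rX.
have cA : B `\` X `<=` A by apply: fsubset_trans BA; apply: fsubsetDl.
have fX := is_comp_flatten_restr cA dA cX.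
rewrite (iconv_cat HP) ?(is_comp_pairwise fB) ?(is_comp_bigU fB) //.
rewrite (is_comp_bigU rX) (is_comp_bigU fX) (is_comp_bigU cX).
apply: (eq_conv HP).
- by apply/disjP => y yX; rewrite inE yX.
- by rewrite fsetUDl fsetDv fsetD0; have /fsetUidPr -> := XB.
- by move=> y _; rewrite /restr_fam (is_comp_bigU dA) (fsubset_trans XB BA).
- by move=> y yc; apply: IH yc.
Qed.

Lemma represents_dmorph phi : represents phi (Peps' P) -> is_dmorph phi.
Proof.
move=> pr; have [ps pf] := pr; have ep := char_pre_char eps'_char; split.
- exact: represents_bimorph eps'_char pr.
- move=> A x xA [c d]; rewrite coef2_phi2 (coef_comp_delta _ _ (ps _ _ xA)) pf //.
  transitivity (\sum_(p <- Pdelta P A x) (is_comp A c && is_comp A d)%:R *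
     (iconv (Peps' P) c p.1 * iconv (Peps' P) d p.2)).
    apply: eq_big_seq => p /(Pdelta_mem HP xA)[p1 p2].
    by rewrite !pf // -mulnb natrM mulrACA.
  rewrite -mulr_sumr; case cA: (is_comp A c); case dA: (is_comp A d); rewrite ?mul0r // !mul1r.
  rewrite (is_comp_flatten_restr (fsubset_refl A) dA cA) mul1r.
  have [cU dU] := (is_comp_bigU cA, is_comp_bigU dA).
  have [cd dd] := (is_comp_pairwise cA, is_comp_pairwise dA).
  rewrite -(iconv_restr_fam ep (fsubset_refl A) dA cA) //.
  rewrite -(iconv_delta HP (restr_fam_pre_char ep dd) cd) cU //.
  (* On all of [A] the restricted family is [iconv] along [d]. *)
  by apply: eq_bigr => p _; rewrite /restr_fam dU fsubset_refl restr_id.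
- exact: represents_eps' eps'_char pr.
Qed.

End UniversalProperty.

Theorem theorem29 (K : fieldType) (P : dtb_data K) :
  is_dtb P -> connected P ->
  exists phi0 : morph P,
    [/\ is_dmorph phi0,
        (forall psi : morph P, is_dmorph psi -> same_morph psi phi0),
        (forall f : charf P, is_char f -> is_bimorph (arrow phi0 f)) &
        (forall phi : morph P, is_bimorph phi -> is_char (eps'_comp phi))]
    /\ (forall f : charf P, is_char f -> same_char (eps'_comp (arrow phi0 f)) f)
    /\ (forall phi : morph P, is_bimorph phi -> same_morph (arrow phi0 (eps'_comp phi)) phi).
Proof.
move=> HP Pconn; have [phi0 p0] := represents_exists (Peps' P).
exists phi0; split; [split|split].
- exact: represents_dmorph.
(* [psi] represents [eps' o psi], which is [Peps' P] by compatibility with the counits of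
   [delta]. *)
- move=> psi [pb _ pe]; exact: (represents_same HP (bimorph_represents HP pb) p0 pe).
- move=> f fc; apply: (represents_bimorph HP Pconn fc); exact: represents_arrow.
- by move=> phi; apply: bimorph_char.
- move=> f fc; apply: (represents_eps' HP Pconn fc); exact: represents_arrow.
(* Both morphisms represent [eps' o phi]. *)
- move=> phi pb; have fc := bimorph_char HP pb.
  by apply: (represents_same HP (represents_arrow HP Pconn fc p0) (bimorph_represents HP pb)).
Qed.
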